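(* Suppose $g_1,g_2\in R^-(M)$ satisfy $S(g_1,g_2)=L(g_1,g_2)$. Then the projection of the Mather set $\mathcal{M}(g_1,g_2)$ to $M$ is contained in the stretch locus from $g_1$ to $g_2$, that is, $$\pi(\mathcal{M}(g_1,g_2))\subset E(g_1,g_2),$$ where $\pi:S^{g_1}M\to M$ is the projection map.
   Context: $M$ is a closed connected oriented smooth manifold of dimension $n\ge 2$ admitting a Riemannian metric of negative sectional curvature; $\widetilde M$ is its universal cover. $R^-(M)$ is the set of smooth Riemannian metrics of negative sectional curvature on $M$. $S^gM$ is the unit tangent bundle and $\phi^g$ the geodesic flow. $\mathcal{M}^1(\phi^{g_1})$ is the set of $\phi^{g_1}$-invariant Borel probability measures on $S^{g_1}M$. Geodesic stretch: for $m\in\mathcal{M}^1(\phi^{g_1})$, $I_m(g_1,g_2)=\int_{S^{g_1}M}\lim_{t\to\infty}\frac1t d_{g_2}(\widetilde c_v(0),\widetilde c_v(t))\,dm(v)$, where $\widetilde c_v$ is a lift to $\widetilde M$ of the unit speed $g_1$-geodesic with initial vector $v$ (the limit exists $m$-a.e.). Maximal stretch: $S(g_1,g_2)=\max_{m}I_m(g_1,g_2)$. $MS(g_1,g_2)=\{m\in\mathcal{M}^1(\phi^{g_1}) : I_m(g_1,g_2)=S(g_1,g_2)\}$. Mather set: $\mathcal{M}(g_1,g_2)=\overline{\bigcup_{m\in MS(g_1,g_2)}\operatorname{supp} m}\subset S^{g_1}M$. $\mathrm{Lip}_{\mathrm{id}}(M,g_1,g_2)$ is the set of Lipschitz maps $(M,g_1)\to(M,g_2)$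 homotopic to the identity. $\mathrm{Lip}(f,g_1,g_2)=\sup_{x\ne x'}d_{g_2}(f(x),f(x'))/d_{g_1}(x,x')$. Least Lipschitz constant: $L(g_1,g_2)=\inf\{\mathrm{Lip}(f,g_1,g_2): f\in\mathrm{Lip}_{\mathrm{id}}(M,g_1,g_2)\}$. Local Lipschitz constant: $\mathrm{Lip}_x(f,g_1,g_2)=\inf_{r>0}\mathrm{Lip}(f|_{\overline B^{g_1}_x(r)},g_1,g_2)$, where $\overline B^{g_1}_x(r)$ is the closed $g_1$-ball of radius $r$ about $x$. Stretch locus of $f$: $E_f(g_1,g_2)=\{x\in M:\mathrm{Lip}_x(f,g_1,g_2)=\mathrm{Lip}(f,g_1,g_2)\}$. Stretch locus from $g_1$ to $g_2$: $E(g_1,g_2)=\bigcap E_f(g_1,g_2)$, the intersection over all $f\in\mathrm{Lip}_{\mathrm{id}}(M,g_1,g_2)$ with $\mathrm{Lip}(f,g_1,g_2)=L(g_1,g_2)$. *)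

(* Defs.v *)
From HB Require Import structures.
From mathcomp Require Import all_boot all_order all_algebra.
From mathcomp Require Import all_classical all_reals all_analysis.

Set Implicit Arguments.
Unset Strict Implicit.
Unset Printing Implicit Defensive.

Import Order.TTheory GRing.Theory Num.Theory.
Import numFieldNormedType.Exports.

Local Open Scope classical_set_scope.
Local Open Scope ring_scope.

(* [f] is C^k on the open set [U]; the values of [f] off [U] are irrelevant. *)
Fixpoint Ck (R : realType) (n : nat) (W : normedModType R) (k : nat)
    (U : set 'rV[R]_n) (f : 'rV[R]_n -> W) : Prop :=
  match k with
  | 0 => forall y, U y -> {for y, continuous f}
  | k'.+1 => (forall y, U y -> differentiable f y) /\
             (forall v : 'rV[R]_n, Ck k' U (fun y => 'D_v f y))
  end.

Definition smooth_on (R : realType) (n : nat) (W : normedModType R)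
    (U : set 'rV[R]_n) (f : 'rV[R]_n -> W) : Prop :=
  forall k, Ck k U f.

(* An oriented smooth structure of dimension n: an atlas of charts
   [crd i : dom i -> R^n] with inverses [crdV i], whose transition maps are
   smooth and orientation preserving.  [crd i] off [dom i] and [crdV i] off
   [crd i @` dom i] are irrelevant. *)
Record oriented_atlas (R : realType) (n : nat) (M : topologicalType) := Atlas {
  chart_index : Type;
  dom : chart_index -> set M;
  crd : chart_index -> M -> 'rV[R]_n;
  crdV : chart_index -> 'rV[R]_n -> M;
  dom_cover : forall x, exists i, dom i x;
  dom_open : forall i, open (dom i);
  crd_open : forall i, open (crd i @` dom i);
  crdK : forall i x, dom i x -> crdV i (crd i x) = x;
  crd_continuous : forall i x, dom i x -> {for x, continuous (crd i)};
  crdV_continuous : forall i y, (crd i @` dom i) y ->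
    {for y, continuous (crdV i)};
  trans_smooth : forall i j,
    smooth_on (crd i @` (dom i `&` dom j)) (crd j \o crdV i);
  trans_oriented : forall i j y, (crd i @` (dom i `&` dom j)) y ->
    0 < \det (jacobian (crd j \o crdV i) y)
}.

Section Manifold.
Context (R : realType) (n : nat) (M : topologicalType).
Variable A : oriented_atlas R n M.
Local Notation I := (chart_index A).

Definition trans (i j : I) : 'rV[R]_n -> 'rV[R]_n := crd j \o crdV i.

Definition chart_at (x : M) : I := sval (cid (dom_cover A x)).

Lemma chart_atP x : dom (chart_at x) x.
Proof. exact: svalP (cid (dom_cover A x)). Qed.

(* A tangent vector at [x] is given by its coordinates in all charts around
   [x], related by the Jacobians of the transition maps (row vectors, so the
   Jacobian acts on the right); the other coordinates are set to 0 so that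
   equality of tangent vectors is Leibniz equality. *)
Definition is_tangent (x : M) (v : I -> 'rV[R]_n) : Prop :=
  (forall i j, dom i x -> dom j x ->
     v j = v i *m jacobian (trans i j) (crd i x)) /\
  (forall i, ~ dom i x -> v i = 0).

(* A smooth Riemannian metric: [gmx i] is the Gram matrix of the coordinate
   frame of chart i, as a function on the open set [crd i @` dom i]. *)
Record metric := Metric {
  gmx : I -> 'rV[R]_n -> 'M[R]_n;
  gmx_sym : forall i y, (crd i @` dom i) y -> (gmx i y)^T = gmx i y;
  gmx_pos : forall i y (v : 'rV[R]_n), (crd i @` dom i) y -> v != 0 ->
    0 < (v *m gmx i y *m v^T) 0 0;
  gmx_smooth : forall i a b,
    smooth_on (crd i @` dom i) (fun y => gmx i y a b : R^o);
  gmx_trans : forall i j x, dom i x -> dom j x ->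
    gmx i (crd i x) = jacobian (trans i j) (crd i x) *m gmx j (crd j x)
                      *m (jacobian (trans i j) (crd i x))^T
}.

Section Curvature.
Variable g : metric.

Definition gprod (i : I) (y u v : 'rV[R]_n) : R :=
  (u *m gmx g i y *m v^T) 0 0.

Definition partial (a : 'I_n) (f : 'rV[R]_n -> R) (y : 'rV[R]_n) : R :=
  'D_(delta_mx 0 a) (f : 'rV[R]_n -> R^o) y.

(* Gamma^k_{ab} *)
Definition christoffel (i : I) (k a b : 'I_n) (y : 'rV[R]_n) : R :=
  2^-1 * \sum_(l < n) invmx (gmx g i y) k l *
    (partial a (fun z => gmx g i z b l) y
     + partial b (fun z => gmx g i z a l) y
     - partial l (fun z => gmx g i z a b) y).

(* R(d_a, d_b) d_c = \sum_l riemann i l a b c * d_l, with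
   R(X,Y) = [nabla_X, nabla_Y] - nabla_[X,Y] *)
Definition riemann (i : I) (l a b c : 'I_n) (y : 'rV[R]_n) : R :=
  partial a (christoffel i l b c) y - partial b (christoffel i l a c) y
  + \sum_(m < n) (christoffel i l a m y * christoffel i m b c y
                  - christoffel i l b m y * christoffel i m a c y).

(* <R(u,v)v, u> / (|u|^2 |v|^2 - <u,v>^2) *)
Definition sectional_curvature (i : I) (y u v : 'rV[R]_n) : R :=
  (\sum_(a < n) \sum_(b < n) \sum_(c < n) \sum_(l < n) \sum_(m < n)
     riemann i l a b c y * gmx g i y l m * u 0 a * v 0 b * v 0 c * u 0 m)
  / (gprod i y u u * gprod i y v v - gprod i y u v ^+ 2).

Definition negatively_curved : Prop :=
  forall i y (u v : 'rV[R]_n), (crd i @` dom i) y -> row_free (col_mx u v) ->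
    sectional_curvature i y u v < 0.

End Curvature.

Section Curves.
Variable g : metric.

Definition C1_at (c : R -> M) (t : R) : Prop :=
  {for t, continuous c} /\
  forall i : I, dom i (c t) ->
    (\forall s \near t, derivable (crd i \o c) s 1) /\
    {for t, continuous (derive1 (crd i \o c))}.

Definition speed (c : R -> M) (t : R) : R :=
  let i := chart_at (c t) in
  let w := derive1 (crd i \o c) t in
  Num.sqrt (gprod g i (crd i (c t)) w w).

Definition arc_length (c : R -> M) (a b : R) : R :=
  \int[lebesgue_measure]_(t in `[a, b]) speed c t.

(* [c] solves the geodesic equation c''^k + Gamma^k_{ab} c'^a c'^b = 0. *)
Definition is_geodesic (c : R -> M) : Prop :=
  continuous c /\
  forall t (i : I), dom i (c t) ->
    let c' := derive1 (crd i \o c) in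
    [/\ \forall s \near t, derivable (crd i \o c) s 1,
        derivable c' t 1 &
        forall k : 'I_n, derive1 c' t 0 k +
          \sum_(a < n) \sum_(b < n)
            christoffel g i k a b (crd i (c t)) * c' t 0 a * c' t 0 b = 0].

(* Piecewise C^1 paths in a space [X] over [M], and their [g]-lengths.  For
   [p] the identity these are the paths of [M]; for [p] a covering map they are
   the paths of the covering space, measured with the pulled back metric (for
   which [p] is a local isometry, in particular a local diffeomorphism). *)
Inductive path_length (X : topologicalType) (p : X -> M) : X -> X -> R -> Prop :=
| path_length_nil x : path_length p x x 0
| path_length_cons (a b : R) (c : R -> X) (y : X) (l : R) :
    a <= b ->
    (forall t, a <= t <= b -> {for t, continuous c} /\ C1_at (p \o c) t) ->
    path_length p (c b) y l ->
    path_length p (c a) y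
      (arc_length (p \o c) a b + l).

Definition riem_dist (X : topologicalType) (p : X -> M) (x y : X) : R :=
  inf [set l | path_length p x y l].

Definition riem_distM : M -> M -> R := riem_dist id.

Record unit_tangent := UnitTangent {
  foot : M;
  vec : I -> 'rV[R]_n;
  vec_tangent : is_tangent foot vec;
  vec_unit : forall i, dom i foot -> gprod g i (crd i foot) (vec i) (vec i) = 1
}.

(* The open sets of the bundle topology: those open in every bundle chart
   [v |-> (crd i (foot v), vec v i)] over [dom i]. *)
Definition ut_open (U : set unit_tangent) : Prop :=
  forall v, U v -> forall i, dom i (foot v) ->
    \forall z \near (crd i (foot v), vec v i),
      forall w, dom i (foot w) -> (crd i (foot w), vec w i) = z -> U w.

Lemma ut_openT : ut_open setT.
Proof. by move=> v _ i _; near=> z. Unshelve. all: by end_near. Qed.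

Lemma ut_openI : setI_closed ut_open.
Proof.
move=> U V oU oV v [Uv Vv] i di.
apply: filterS2 (oU v Uv i di) (oV v Vv i di) => z h1 h2 w dw e.
by split; [exact: h1|exact: h2].
Qed.

Lemma ut_open_bigcup (J : Type) (F : J -> set unit_tangent) :
  (forall j, ut_open (F j)) -> ut_open (\bigcup_j F j).
Proof.
move=> oF v [j _ Fv] i di.
by apply: filterS (oF j v Fv i di) => z h w dw e; exists j => //; exact: h.
Qed.

HB.instance Definition _ := gen_eqMixin unit_tangent.
HB.instance Definition _ := gen_choiceMixin unit_tangent.
HB.instance Definition _ :=
  isOpenTopological.Build unit_tangent ut_openT ut_openI ut_open_bigcup.

End Curves.

End Manifold.

(* The measure theory library requires measurable types to be inhabited, hence
   the construction of a unit tangent vector. *)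
Section UnitVectorExists.
Context (R : realType) (n : nat) (M : ptopologicalType).
Variables (A : oriented_atlas R n.+1 M) (g : metric A).

Lemma jacobian_comp (k l m : nat) (f : 'rV[R]_k -> 'rV[R]_l)
    (h : 'rV[R]_l -> 'rV[R]_m) (y : 'rV[R]_k) :
  differentiable f y -> differentiable h (f y) ->
  jacobian (h \o f) y = jacobian f y *m jacobian h (f y).
Proof.
move=> df dh; apply/row_matrixP => a; rewrite !rowE mulmxA.
by rewrite /jacobian !mul_rV_lin1 diff_comp.
Qed.

Lemma mulmx_eq (k l : nat) (B C : 'M[R]_(k, l)) :
  (forall v : 'rV[R]_k, v *m B = v *m C) -> B = C.
Proof. by move=> BC; apply/row_matrixP => a; rewrite !rowE. Qed.

Lemma near_eq_jacobian (k l : nat) (f h : 'rV[R]_k -> 'rV[R]_l)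
    (y : 'rV[R]_k) :
  differentiable h y -> differentiable f y -> {near y, f =1 h} ->
  jacobian f y = jacobian h y.
Proof.
move=> dh df fh; apply: mulmx_eq => v.
have e1 := deriveEjacobian v df.
have e2 := deriveEjacobian v dh.
exact: (etrans (esym e1) (etrans (near_eq_derive v fh) e2)).
Qed.

Lemma trans_differentiable (i j : chart_index A) (x : M) :
  dom i x -> dom j x -> differentiable (trans i j) (crd i x).
Proof.
by move=> di dj; have [+ _] := trans_smooth i j 1; apply; exists x.
Qed.

Lemma jacobian_trans (x : M) (i j k : chart_index A) :
  dom i x -> dom j x -> dom k x ->
  jacobian (trans i k) (crd i x) =
  jacobian (trans i j) (crd i x) *m jacobian (trans j k) (crd j x).
Proof.
move=> di dj dk.
have tx : trans i j (crd i x) = crd j x by rewrite /trans /= crdK.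
have dij := trans_differentiable di dj.
have djk : differentiable (trans j k) (trans i j (crd i x)).
  by rewrite tx; exact: trans_differentiable.
have E : {near crd i x, trans i k =1 trans j k \o trans i j}.
  have U1 : \forall y \near crd i x, (crd i @` dom i) y.
    by apply: open_nbhs_nbhs; split; [exact: crd_open|exists x].
  have U2 : \forall y \near crd i x, dom j (crdV i y).
    apply: (@crdV_continuous _ _ _ A i (crd i x)); first by exists x.
    by rewrite crdK//; apply: open_nbhs_nbhs; split; [exact: dom_open|].
  apply: filterS2 U1 U2 => y [z dz <-]; rewrite crdK// => djz.
  by rewrite /trans /= !crdK.
have dcomp := differentiable_comp dij djk.
have e1 := near_eq_jacobian dcomp (trans_differentiable di dk) E.
have e2 := jacobian_comp dij djk.
by rewrite tx in e2; exact: (etrans e1 e2).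
Qed.

Lemma unit_tangent_inhabited : exists v : unit_tangent g, True.
Proof.
pose x : M := point; pose i0 := chart_at A x.
have d0 : dom i0 x := chart_atP A x.
pose w : 'rV[R]_n.+1 := delta_mx 0 0.
have w0 : w != 0.
  by apply/eqP => /matrixP /(_ 0 0) /eqP; rewrite !mxE !eqxx oner_eq0.
pose q := gprod g i0 (crd i0 x) w w.
have q0 : 0 < q by apply: gmx_pos => //; exists x.
pose u := (Num.sqrt q)^-1 *: w.
have u1 : gprod g i0 (crd i0 x) u u = 1.
  have uT : u^T = (Num.sqrt q)^-1 *: w^T by apply/matrixP => a b; rewrite !mxE.
  rewrite /gprod uT -scalemxAr mxE /u -scalemxAl -scalemxAl mxE.
  rewrite -/(gprod g i0 (crd i0 x) w w) -/q mulrA -invfM -expr2.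
  by rewrite sqr_sqrtr ?ltW// mulVf// gt_eqF.
pose vec i : 'rV[R]_n.+1 := if pselect (dom i x)
  then u *m jacobian (trans i0 i) (crd i0 x) else 0.
have vecE i : dom i x -> vec i = u *m jacobian (trans i0 i) (crd i0 x).
  move=> di; rewrite /vec; case: (pselect (dom i x)) => [dd|nd] /=.
    reflexivity.
  by case: (nd di).
have vt : is_tangent x vec.
  split=> [i j di dj|i ndi]; last first.
    rewrite /vec; case: (pselect (dom i x)) => [di|dd] /=; last by [].
    by case: (ndi di).
  have e := jacobian_trans d0 di dj.
  by rewrite (vecE i di) (vecE j dj) e mulmxA.
have vu i : dom i x -> gprod g i (crd i x) (vec i) (vec i) = 1.
  move=> di; apply: etrans u1; rewrite /gprod (vecE i di).
  by rewrite (gmx_trans g d0 di) trmx_mul !mulmxA.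
by exists (UnitTangent vt vu).
Qed.

HB.instance Definition _ :=
  isPointed.Build (unit_tangent g) (sval (cid unit_tangent_inhabited)).

End UnitVectorExists.

Definition msupport (R : realType) (T : ptopologicalType)
    (m : set (g_sigma_algebraType (@open T)) -> \bar R) : set T :=
  [set x | forall U : set T, open U -> U x -> (0 < m U)%E].

Section Covering.
Context (R : realType).

Definition covering_map (X Y : topologicalType) (p : X -> Y) : Prop :=
  continuous p /\ (forall y, exists x, p x = y) /\
  forall y, exists U : set Y, [/\ open U, U y &
    exists (J : Type) (s : J -> Y -> X),
      [/\ forall a, open (s a @` U),
          forall a z, U z -> p (s a z) = z /\ {for z, continuous (s a)},
          trivIset setT (fun a => s a @` U) &
          p @^-1` U = \bigcup_a (s a @` U)]].

Definition unit_interval : set R := `[0, 1].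

Definition simply_connected (X : topologicalType) : Prop :=
  (forall x y : X, exists c : R -> X,
     [/\ {within unit_interval, continuous c}, c 0 = x & c 1 = y]) /\
  (forall c : R -> X, {within unit_interval, continuous c} -> c 0 = c 1 ->
     exists H : R * R -> X,
       {within unit_interval `*` unit_interval, continuous H} /\
       forall s, unit_interval s ->
         [/\ H (0, s) = c s, H (1, s) = c 0, H (s, 0) = c 0 & H (s, 1) = c 0]).

Definition universal_covering (X Y : topologicalType) (p : X -> Y) : Prop :=
  covering_map p /\ simply_connected X.

Definition homotopic_to_id (Y : topologicalType) (f : Y -> Y) : Prop :=
  exists H : R * Y -> Y,
    {within unit_interval `*` [set: Y], continuous H} /\
    forall y, H (0, y) = y /\ H (1, y) = f y.

Definition is_lift (X Y : topologicalType) (p : X -> Y) (c : R -> Y)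
    (c' : R -> X) : Prop :=
  continuous c' /\ forall t, p (c' t) = c t.

End Covering.

Section GeodesicFlow.
Context (R : realType) (n : nat) (M : topologicalType).
Variables (A : oriented_atlas R n M) (g : metric A).

Definition orbit_foot (phi : R -> unit_tangent g -> unit_tangent g)
    (v : unit_tangent g) : R -> M := fun t => foot (phi t v).

(* Orbits are the geodesics with prescribed initial velocity, so this
   determines [phi]. *)
Definition is_geodesic_flow
    (phi : R -> unit_tangent g -> unit_tangent g) : Prop :=
  [/\ forall v, phi 0 v = v,
      forall s t v, phi (s + t) v = phi s (phi t v),
      continuous (fun z : R * unit_tangent g => phi z.1 z.2) &
      forall v, is_geodesic g (orbit_foot phi v) /\
        forall t (i : chart_index A), dom i (foot (phi t v)) ->
          derive1 (crd i \o orbit_foot phi v) t = vec (phi t v) i].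

End GeodesicFlow.

Section Stretch.
Context (R : realType) (n : nat) (M : ptopologicalType).
Variables (A : oriented_atlas R n.+1 M) (g1 g2 : metric A).
Local Notation SM := (unit_tangent g1).
Local Notation borelSM := (g_sigma_algebraType (@open SM)).

Definition flow_invariant (phi : R -> SM -> SM) (m : probability borelSM R) : Prop :=
  forall t (B : set borelSM), measurable B -> m (phi t @^-1` B) = m B.

(* [lft v] is a lift to the universal cover of the geodesic with initial
   vector [v]; the distance below does not depend on the choice of the lift,
   since deck transformations are isometries of the pulled back metric.  The
   limit exists almost everywhere; where it does not, [lim] is 0. *)
Definition geodesic_stretch (X : topologicalType) (p : X -> M)
    (lft : SM -> R -> X) (m : probability borelSM R) : \bar R :=
  (\int[m]_(v in setT)
     (lim (riem_dist g2 p (lft v 0) (lft v t) / t @[t --> +oo%R]))%:E)%E.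

(* A supremum, which is attained: [geodesic_stretch] is upper semicontinuous
   on the compact space of invariant probability measures. *)
Definition max_stretch (phi : R -> SM -> SM) (X : topologicalType) (p : X -> M)
    (lft : SM -> R -> X) : \bar R :=
  ereal_sup [set geodesic_stretch p lft m | m in flow_invariant phi].

Definition maximizing (phi : R -> SM -> SM) (X : topologicalType) (p : X -> M)
    (lft : SM -> R -> X) : set (probability borelSM R) :=
  [set m | flow_invariant phi m /\
           geodesic_stretch p lft m = max_stretch phi p lft].

Definition mather_set (phi : R -> SM -> SM) (X : topologicalType) (p : X -> M)
    (lft : SM -> R -> X) : set SM :=
  closure (\bigcup_(m in maximizing phi p lft) msupport m).

Definition lip_on (D : set M) (f : M -> M) : \bar R :=
  ereal_sup [set z | exists x x', [/\ D x, D x', x <> x' &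
    z = (riem_distM g2 (f x) (f x') / riem_distM g1 x x')%:E]].

Definition lip (f : M -> M) : \bar R := lip_on setT f.

Definition lip_id : set (M -> M) :=
  [set f | (lip f < +oo)%E /\ homotopic_to_id R f].

Definition least_lip : \bar R := ereal_inf [set lip f | f in lip_id].

Definition local_lip (x : M) (f : M -> M) : \bar R :=
  ereal_inf [set lip_on [set y | riem_distM g1 x y <= r] f | r in [set r | 0 < r]].

Definition stretch_locus_of (f : M -> M) : set M :=
  [set x | local_lip x f = lip f].

Definition stretch_locus : set M :=
  \bigcap_(f in [set f | lip_id f /\ lip f = least_lip]) stretch_locus_of f.

End Stretch.

(* Main.v *)
Require Import Defs.
From HB Require Import structures.
From mathcomp Require Import all_boot all_order all_algebra.
From mathcomp Require Import all_classical all_reals all_analysis.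
From mathcomp Require Import measurable_realfun lra ring.

(** Let [f] be homotopic to the identity with optimal constant
    [L = lip g1 g2 f], and suppose that near [x] it is [K]-Lipschitz with
    [K < L].  A [g1]-geodesic of length [T] is mapped by [f] to a curve of
    [g2]-length at most [L * T], and at most [L * T - (L - K) * T'] if it spends
    the time [T'] near [x].  Since [f] is homotopic to the identity, a lift of
    this image curve to the universal covering stays at bounded distance from
    the lifted geodesic, so the same bound, up to a constant, holds for the
    distance between the endpoints of the lifted geodesic.  Dividing by [T] and
    integrating against an invariant measure [m], the stretch of [m] is at most
    [L - (L - K) * m B], where [B] consists of the vectors with foot near [x].
    If [x] is the foot of a vector of the Mather set, some maximizing [m] has
    [m B > 0], so the maximal stretch is less than [L].  Where it equals [L],
    [x] is therefore in the stretch locus of [f].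

    The estimate is made on a discrete set of times.  The homotopy is lifted on
    a grid, square by square ([dist_le_image_chain]), and the time average of
    finitely many indicators is integrated by invariance; the limit is taken
    with Fatou's lemma ([integral_le_time_average]), which asks for neither the
    ergodic theorem nor the measurability of the stretch.
    [geodesic_stretch_le] combines the two.

    Lifting on a grid takes a number [rho] such that, in the covering, points
    at distance less than [rho] over the same point of [M] are equal, and
    [rho]-close points of [M] have lifts that are as close
    ([exists_uniform_sheets], [lift_close_point], [close_points_eq]).  It comes
    from functions supported in evenly covered sets which decrease along a path
    by at most its length ([exists_length_lipschitz_bump]): a path shorter than
    the value of such a function at its origin cannot leave the evenly covered
    set, hence lifts, or stays in one sheet.  Bounding the variation of these
    functions by lengths is a matter of local comparison with a chart
    ([gprod_pinch]) and of integrating an inequality between difference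
    quotients ([dist_le_Rintegral]). *)

Set Implicit Arguments.
Unset Strict Implicit.
Unset Printing Implicit Defensive.

Import Order.TTheory GRing.Theory Num.Theory.
Import numFieldNormedType.Exports.

Local Open Scope classical_set_scope.
Local Open Scope ring_scope.

(** * Integrals of speeds *)

Section SpeedIntegral.
Context {R : realType}.
Local Notation mu := (@lebesgue_measure R).
Implicit Types (F sp : R -> R) (a b : R).

Lemma integrable_itv_cc sp a b : {within `[a, b], continuous sp} ->
  mu.-integrable `[a, b] (EFin \o sp).
Proof. by apply: continuous_compact_integrable; exact: segment_compact. Qed.

Lemma within_itv_sub sp a b a' b' : a <= a' -> b' <= b ->
  {within `[a, b], continuous sp} -> {within `[a', b'], continuous sp}.
Proof.
move=> aa bb; apply: continuous_subspaceW; apply: subset_itv; by rewrite bnd_simp.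
Qed.

Lemma Rintegral_itv_split sp a b c : a <= b -> b <= c ->
  {within `[a, c], continuous sp} ->
  \int[mu]_(t in `[a, c]) sp t =
  \int[mu]_(t in `[a, b]) sp t + \int[mu]_(t in `[b, c]) sp t.
Proof.
move=> ab bc /integrable_itv_cc isp.
have := @Rintegral_itvB _ sp (BLeft a) (BRight c) b isp.
rewrite !bnd_simp => /(_ ab bc) E.
rewrite -(Rintegral_itv_obnd_cbnd (r := b)); last first.
  apply: (integrableS _ _ _ isp) => //.
  by apply: subset_itv; rewrite bnd_simp.
by rewrite -E addrC subrK.
Qed.

Lemma Rintegral_itv_cst k a b : a <= b ->
  \int[mu]_(t in `[a, b]) k = k * (b - a).
Proof.
move=> ab; rewrite Rintegral_cst// [X in fine X]lebesgue_measure_itv/= lte_fin.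
by move: ab; rewrite le_eqVlt => /predU1P[->|->//]; rewrite ltxx subrr.
Qed.

Lemma integrable_itv_cst k a b : mu.-integrable `[a, b] (EFin \o cst k).
Proof.
by apply: integrable_itv_cc; apply: continuous_subspaceT => ?; exact: cvg_cst.
Qed.

Lemma Rintegral_itv_ge sp a b k : a <= b ->
  {within `[a, b], continuous sp} -> (forall t, a <= t <= b -> k <= sp t) ->
  k * (b - a) <= \int[mu]_(t in `[a, b]) sp t.
Proof.
move=> ab csp ksp; rewrite -Rintegral_itv_cst//.
apply: le_Rintegral => //; first exact: integrable_itv_cst.
exact: integrable_itv_cc.
Qed.

Lemma Rintegral_itv_le sp a b k : a <= b ->
  {within `[a, b], continuous sp} -> (forall t, a <= t <= b -> sp t <= k) ->
  \int[mu]_(t in `[a, b]) sp t <= k * (b - a).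
Proof.
move=> ab csp ksp; rewrite -Rintegral_itv_cst//.
apply: le_Rintegral => //; first exact: integrable_itv_cc.
exact: integrable_itv_cst.
Qed.

(** A pointwise bound on the difference quotients of [F] integrates to a bound
    on its increments; since [F] need not be differentiable, this applies to
    distance functions.  The set of endpoints up to which the bound holds
    within [e] is closed under suprema and can always be enlarged. *)
Lemma dist_le_Rintegral F sp a b : a <= b ->
  {within `[a, b], continuous sp} ->
  (forall t, a <= t <= b -> forall e, 0 < e -> \forall s \near t,
     a <= s <= b -> `|F s - F t| <= (sp t + e) * `|s - t|) ->
  `|F b - F a| <= \int[mu]_(t in `[a, b]) sp t.
Proof.
move=> ab csp Fsp; apply/ler_addgt0Pr => e0 e0_gt0.
(* The summand 1 keeps the quotient meaningful when [a = b]. *)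
pose e := e0 / (b - a + 1); have ba1 : 0 < b - a + 1 by lra.
have e_gt0 : 0 < e by rewrite divr_gt0.
pose P t s := `|F s - F t| <= \int[mu]_(u in `[t, s]) sp u + e * (s - t).
have Padd t s u : a <= t -> t <= s -> s <= u -> u <= b ->
    P t s -> P s u -> P t u.
  move=> ta ts su ub Pts Psu; rewrite /P (@Rintegral_itv_split sp t s u)//.
    rewrite /P in Pts Psu; apply: le_trans (ler_distD (F s) _ _) _; lra.
  exact: within_itv_sub csp.
have Ploc t : a <= t <= b -> \forall s \near t, a <= s <= b ->
    (t <= s -> P t s) /\ (s <= t -> P s t).
  move=> tab; have e2 : 0 < e / 2 by rewrite divr_gt0.
  have csp_t : \forall s \near t, a <= s <= b -> `|sp t - sp s| < e / 2.
    have /subspace_continuousP/(_ t) := csp.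
    rewrite /= in_itv/= => /(_ tab)/cvgrPdist_lt/(_ _ e2).
    by rewrite near_withinE; apply: filterS => s /=; rewrite in_itv.
  have [d /= d0 dsp] := csp_t.
  have [d' /= d'0 dF] := Fsp t tab _ e2.
  exists (Num.min d d') => /=; first by rewrite lt_min d0.
  move=> s; rewrite /= lt_min => /andP[sd sd'] sab.
  have Fs := dF s sd' sab.
  have spu u : `|t - u| < d -> a <= u <= b -> sp t - e / 2 <= sp u.
    by move=> tu uab; have := dsp u tu uab; rewrite ltr_norml => /andP[]; lra.
  split=> [ts|st].
    have : (sp t - e / 2) * (s - t) <= \int[mu]_(u in `[t, s]) sp u.
      apply: Rintegral_itv_ge => //; first by apply: within_itv_sub csp; lra.
      move=> u tus; apply: spu; last lra.
      by apply: le_lt_trans sd; rewrite !ler0_norm; lra.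
    rewrite /P; move: Fs; rewrite (ger0_norm (x := s - t)); last lra.
    move=> Fs; lra.
  have : (sp t - e / 2) * (t - s) <= \int[mu]_(u in `[s, t]) sp u.
    apply: Rintegral_itv_ge => //; first by apply: within_itv_sub csp; lra.
    move=> u tus; apply: spu; last lra.
    by apply: le_lt_trans sd; rewrite !ger0_norm; lra.
  rewrite /P; move: Fs; rewrite (ler0_norm (x := s - t)); last lra.
  rewrite (distrC (F t)) => Fs; lra.
pose S := [set t | a <= t <= b /\ P a t].
have Sa : S a.
  split; first lra.
  by rewrite /P !subrr normr0 mulr0 addr0 set_itv1 Rintegral_set1.
have supS : has_sup S by split; [exists a|exists b => t [/andP[]]].
pose tau := sup S.
have tab : a <= tau <= b.
  apply/andP; split; first exact: (ub_le_sup supS.2).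
  by apply: ge_sup; [exists a|move=> t [/andP[]]].
have [d /= d0 dP] := Ploc _ tab.
have [t St td] := sup_adherent d0 supS; rewrite -/tau in td.
have ttau : t <= tau by exact: (ub_le_sup supS.2).
have Ptau : P a tau.
  have [tb Pat] := St; apply: (Padd a t tau) => //; try lra.
  have h1 : `|tau - t| < d by rewrite ger0_norm; lra.
  by have [_] := dP t h1 tb; exact.
have taub : tau = b.
  apply/eqP; rewrite eq_le (andP tab).2 leNgt; apply/negP => taub.
  pose s := Num.min b (tau + d / 2).
  have s1 : tau < s by rewrite lt_min taub; lra.
  have s2 : s <= b by rewrite ge_min lexx.
  have s3 : s <= tau + d / 2 by rewrite ge_min lexx orbT.
  have Pts : P tau s.
    have h1 : `|tau - s| < d by rewrite ler0_norm; lra.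
    have h2 : a <= s <= b by lra.
    have [h _] := dP s h1 h2; apply: h; exact: ltW.
  have : S s by split; [lra|apply: (Padd a tau s) => //; lra].
  by move=> /(ub_le_sup supS.2); rewrite -/tau leNgt s1.
move: Ptau; rewrite taub /P => /le_trans; apply; rewrite lerD2l /e.
by rewrite mulrAC ler_pdivrMr// ler_pM2l//; lra.
Qed.

End SpeedIntegral.

(** * Lengths in charts *)

Lemma derivable_lipschitz_at (R : realType) (W : normedModType R) (c : R -> W)
    (t e : R) : derivable c t 1 -> 0 < e ->
  \forall s \near t, `|c s - c t| <= (`|derive1 c t| + e) * `|s - t|.
Proof.
move=> dc e0.
have lim : h^-1 *: (c (h + t) - c t) @[h --> 0^'] --> derive1 c t.
  suff /funext E : (fun h => h^-1 *: (c (h + t) - c t)) =1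
      (fun h => h^-1 *: ((c \o shift t) (h *: 1) - c t)).
    by rewrite /derive1 E.
  by move=> h; rewrite /= [h%:A]mulr1.
have : \forall h \near 0^', `|h^-1 *: (c (h + t) - c t)| < `|derive1 c t| + e.
  by apply: (cvgr_lt _ (cvg_norm lim)); rewrite ltrDl.
move=> [d /= d0 H]; exists d => //= s std.
have [->|st] := eqVneq s t; first by rewrite !subrr !normr0 mulr0.
have st0 : s - t != 0 by rewrite subr_eq0.
have std' : `|0 - (s - t)| < d by rewrite sub0r normrN distrC.
have /= := H (s - t) std' st0.
rewrite subrK normrZ normfV => /ltW.
by rewrite ler_pdivrMl ?normr_gt0// mulrC.
Qed.

Section LocalGeometry.
Context (R : realType) (n' : nat) (M : ptopologicalType).
Local Notation n := n'.+1.
Variables (A : oriented_atlas R n M) (g : metric A).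
Local Notation I := (chart_index A).
Implicit Types (c : R -> M) (i j : I) (x : M) (t : R).

Lemma near_dom c i t : {for t, continuous c} -> dom i (c t) ->
  \forall s \near t, dom i (c s).
Proof.
move=> cc di; apply: (cc (dom i)).
by apply: open_nbhs_nbhs; split => //; exact: dom_open.
Qed.

Lemma near_crd_image i x : dom i x ->
  \forall z \near crd i x, (crd i @` dom i) z.
Proof.
move=> di; apply: open_nbhs_nbhs; split; [exact: crd_open|by exists x].
Qed.

Lemma derive1_crd_trans c i j t : {for t, continuous c} ->
  dom i (c t) -> dom j (c t) -> derivable (crd j \o c) t 1 ->
  derivable (crd i \o c) t 1 /\
  derive1 (crd i \o c) t
    = derive1 (crd j \o c) t *m jacobian (trans j i) (crd j (c t)).
Proof.
move=> cc di dj dc.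
have E : {near t, trans j i \o (crd j \o c) =1 crd i \o c}.
  by apply: filterS (near_dom cc dj) => s dcs; rewrite /= /trans /= crdK.
have dT : differentiable (trans j i) ((crd j \o c) t).
  exact: (trans_differentiable dj di).
have dC : differentiable (crd j \o c) t by apply/derivable1_diffP.
split.
  have dTC : derivable (trans j i \o (crd j \o c)) t 1.
    by apply/derivable1_diffP; exact: differentiable_comp.
  exact: (near_eq_derivable E dTC).
rewrite !derive1E -(near_eq_derive _ E) deriveE; last exact: differentiable_comp.
by rewrite diff_comp//= -deriveE// deriveEjacobian// deriveE.
Qed.

Lemma gprod_trans i j x (u v : 'rV[R]_n) : dom i x -> dom j x ->
  gprod g j (crd j x) (u *m jacobian (trans i j) (crd i x))
    (v *m jacobian (trans i j) (crd i x)) = gprod g i (crd i x) u v.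
Proof.
by move=> di dj; rewrite /gprod (gmx_trans g di dj) trmx_mul !mulmxA.
Qed.

(** The chart in which [speed] is measured jumps with the point; the transition
    rules for velocities and metrics make any other chart as good. *)
Lemma speedE c i t : {for t, continuous c} -> dom i (c t) ->
  derivable (crd i \o c) t 1 ->
  speed g c t = Num.sqrt (gprod g i (crd i (c t)) (derive1 (crd i \o c) t)
                            (derive1 (crd i \o c) t)).
Proof.
move=> cc di dc; have dk := chart_atP A (c t).
have [_ E] := derive1_crd_trans cc dk di dc.
by rewrite /speed E gprod_trans.
Qed.

Lemma gprodE i z (u v : 'rV[R]_n) : gprod g i z u v =
  \sum_k (\sum_l u 0 l * gmx g i z l k) * v 0 k.
Proof.
rewrite /gprod mxE; apply: eq_bigr => k _.
by rewrite !mxE.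
Qed.

Lemma cvg_gprod (T : Type) (F : set_system T) {FF : Filter F} i
    (ze w : T -> 'rV[R]_n) z0 w0 : (crd i @` dom i) z0 ->
  ze @ F --> z0 -> w @ F --> w0 ->
  gprod g i (ze t) (w t) (w t) @[t --> F] --> gprod g i z0 w0 w0.
Proof.
move=> iz cze cw; rewrite gprodE.
under eq_cvg do rewrite gprodE.
have crdw k : w t 0 k @[t --> F] --> w0 0 k.
  exact: (cvg_comp w (fun v : 'rV[R]_n => v 0 k) cw (@coord_continuous _ _ _ _ _ _)).
apply: cvg_big => [|k _]; first exact: add_continuous.
apply: cvgM; last exact: crdw.
apply: cvg_big => [|l _]; first exact: add_continuous.
apply: cvgM; first exact: crdw.
have ck := gmx_smooth g i l k 0%N z0 iz.
exact: (cvg_comp _ _ cze ck).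
Qed.

Lemma gprodZ i z a (w : 'rV[R]_n) :
  gprod g i z (a *: w) (a *: w) = a ^+ 2 * gprod g i z w w.
Proof.
rewrite /gprod linearZ/= -scalemxAr mxE -scalemxAl -scalemxAl mxE.
by rewrite mulrA expr2.
Qed.

(** The unit sphere for the coordinate norm is compact, so on it the positive
    continuous function [gprod] is pinched between positive constants, locally
    uniformly in the base point; homogeneity does the rest. *)
Lemma gprod_pinch i z0 : (crd i @` dom i) z0 ->
  exists2 k, 0 < k & \forall z \near z0, forall w : 'rV[R]_n,
    k * `|w| <= Num.sqrt (gprod g i z w w) <= k^-1 * `|w|.
Proof.
move=> iz0.
pose S := [set w : 'rV[R]_n | `|w| = 1].
have cS : compact S.
  apply: bounded_closed_compact.
    exists 1; split; first by rewrite num_real.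
    by move=> m m1 w /= ->; exact: ltW.
  rewrite (_ : S = Num.norm @^-1` [set 1])//.
  by apply: preimage_closed => [w _|]; [exact: norm_continuous|exact: closed_eq].
(* Compactness is applied to the constant and the base point together. *)
have H : \forall kz \near filter_prod (0^'+ : set_system R) (nbhs z0),
    S `<=` (fun w => kz.1 ^+ 2 <= gprod g i kz.2 w w <= kz.1^-1 ^+ 2).
  apply: ((compact_near_coveringP S).1 cS) => w w1.
  have iw : 0 < gprod g i z0 w w.
    by apply: gmx_pos => //; apply/eqP => w0; move: w1; rewrite /S/= w0 normr0;
       move/eqP; rewrite eq_sym oner_eq0.
  pose q := gprod g i z0 w w; have q0 : 0 < q := iw.
  have [[P Q] /= [Pz0 Qw] PQ] : \forall zw \near (z0, w),
      q / 2 < gprod g i zw.1 zw.2 zw.2 < q * 2.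
    have H : (fun zw : 'rV[R]_n * 'rV[R]_n => gprod g i zw.1 zw.2 zw.2)
        @ (z0, w) --> q.
      by apply: cvg_gprod iz0 _ _; [exact: cvg_fst|exact: cvg_snd].
    near=> zw; apply/andP; split; near: zw.
      by apply: (cvgr_gt _ H) => /=; rewrite -/q; lra.
    by apply: (cvgr_lt _ H) => /=; rewrite -/q; lra.
  (* Since [k < K <= 1], the square of [k] is at most [k], and that of its
     inverse at least its inverse. *)
  pose K := Num.min 1 (Num.min (q / 2) (q * 2)^-1).
  have K0 : 0 < K by rewrite !lt_min ltr01/= divr_gt0//= invr_gt0 mulr_gt0.
  exists (Q, [set kz : R * 'rV[R]_n | 0 < kz.1 < K /\ P kz.2]).
    split=> //=; exists ([set k | 0 < k < K], P); last by move=> [k z] [].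
    split=> //=; near=> k; apply/andP; split; near: k.
      exact: nbhs_right_gt.
    exact: nbhs_right_lt.
  move=> [w' [k z]] /= [Qw' [/andP[k0 kK] Pz]].
  have /= /andP[lo hi] := PQ (z, w') (conj Pz Qw').
  move: kK; rewrite !lt_min => /and3P[k1 kq kq'].
  have kk : k ^+ 2 <= k by rewrite expr2 ger_pMl// ltW.
  apply/andP; split; first by lra.
  apply: le_trans (ltW hi) _.
  have : q * 2 <= k^-1.
    by rewrite -[q * 2]invrK lef_pV2 ?posrE ?invr_gt0 ?mulr_gt0// ltW.
  move=> /le_trans; apply; rewrite expr2 ler_pMr ?invr_gt0//.
  by rewrite invf_ge1// ltW.
have [[P Q] /= [P0 Qz0] PQ] := H.
have [k [Pk k0]] : exists k, P k /\ 0 < k.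
  near (0 : R)^'+ => k; exists k; split; near: k; first exact: P0.
  exact: nbhs_right_gt.
exists k => //; apply: filterS Qz0 => z Qz w.
have [->|w0] := eqVneq w 0.
  rewrite /gprod mul0mx mul0mx mxE sqrtr0 normr0 !mulr0 lexx//.
have nw : 0 < `|w| by rewrite normr_gt0.
have := PQ (k, z) (conj Pk Qz) (`|w|^-1 *: w).
rewrite /S /= normrZ normfV normr_id mulVf ?gt_eqF// => /(_ erefl).
rewrite gprodZ !exprVn /= => /andP[lo hi].
have nw2 : 0 < `|w| ^+ 2 by rewrite exprn_gt0.
have g0 : 0 <= gprod g i z w w.
  have iw2 : 0 < (`|w| ^+ 2)^-1 by rewrite invr_gt0.
  by rewrite -(pmulr_rge0 _ iw2); apply: le_trans lo; rewrite sqr_ge0.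
apply/andP; split.
  rewrite -ler_sqr ?nnegrE ?sqrtr_ge0 ?mulr_ge0 ?(ltW k0)//.
  by rewrite sqr_sqrtr// exprMn -ler_pdivlMr// [gprod _ _ _ _ _ / _]mulrC.
rewrite -ler_sqr ?nnegrE ?sqrtr_ge0 ?mulr_ge0 ?invr_ge0 ?(ltW k0)//.
by rewrite sqr_sqrtr// exprMn exprVn -ler_pdivrMr// [gprod _ _ _ _ _ / _]mulrC.
Unshelve. all: by end_near. Qed.

End LocalGeometry.

(** * Bumps and coordinate segments *)

Lemma cvg_near_eq (T U : Type) (F : set_system T) {FF : Filter F}
    (G : set_system U) (f h : T -> U) :
  {near F, f =1 h} -> f @ F `=>` G -> h @ F `=>` G.
Proof. by move=> fh; apply: cvg_trans; exact: near_eq_cvg. Qed.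

Section ShortCurves.
Context (R : realType) (n' : nat) (M : ptopologicalType).
Local Notation n := n'.+1.
Variables (A : oriented_atlas R n M) (g : metric A).
Local Notation I := (chart_index A).
Implicit Types (c : R -> M) (i j : I) (x : M) (t : R).

Lemma crd_comp_continuous c i t : {for t, continuous c} -> dom i (c t) ->
  crd i (c s) @[s --> t] --> crd i (c t).
Proof. by move=> cc di; exact: (cvg_comp _ _ cc (crd_continuous di)). Qed.

(** Near [t] the speed can be read in the single chart around [c t], where it is
    continuous.  At times outside the interval [c] need not even be
    continuous. *)
Lemma speed_continuous c a b : (forall t, a <= t <= b -> C1_at A c t) ->
  {within `[a, b], continuous (speed g c)}.
Proof.
move=> C1; suff key t : a <= t <= b ->
    speed g c s @[s --> within `[a, b] (nbhs t)] --> speed g c t.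
  by apply/subspace_continuousP => t /=; rewrite in_itv/=; exact: key.
move=> tab.
have [cc Cc] := C1 t tab.
have di := chart_atP A (c t); set i := chart_at A (c t) in di.
have [dc cdc] := Cc i di.
pose q s := gprod g i (crd i (c s)) (derive1 (crd i \o c) s)
              (derive1 (crd i \o c) s).
have iz : (crd i @` dom i) (crd i (c t)) by exists (c t).
have dct : derivable (crd i \o c) t 1 by exact: nbhs_singleton dc.
have cq : Num.sqrt (q s) @[s --> t] --> speed g c t.
  rewrite (speedE _ cc di dct).
  have cqt : q s @[s --> t] --> q t.
    exact: (cvg_gprod iz (crd_comp_continuous cc di) cdc).
  exact: (cvg_comp _ _ cqt (@sqrt_continuous R _)).
have E : {near within `[a, b] (nbhs t), (Num.sqrt \o q) =1 speed g c}.
  rewrite near_withinE.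
  apply: filterS2 dc (near_dom cc di) => s dcs dis; rewrite /= in_itv/= => sab.
  by rewrite (speedE _ (C1 s sab).1 dis dcs).
exact: (cvg_near_eq E (cvg_within_filter _ cq)).
Qed.

Lemma arc_length_ge0 c a b : 0 <= arc_length g c a b.
Proof.
rewrite /arc_length /Rintegral fine_ge0//; apply: integral_ge0 => t _.
by rewrite lee_fin sqrtr_ge0.
Qed.

(** The functions that are 1-Lipschitz for the path metric, tested on single
    curves so that they can bound lengths from below before any distance is
    considered. *)
Definition length_lipschitz (b : M -> R) := forall c s t, s <= t ->
  (forall u, s <= u <= t -> C1_at A c u) ->
  `|b (c t) - b (c s)| <= arc_length g c s t.

Lemma near_closed_ball (z0 : 'rV[R]_n) (P : set 'rV[R]_n) : nbhs z0 P ->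
  exists2 r, 0 < r & forall z, `|z - z0| <= r -> P z.
Proof.
move=> /nbhs_ballP[/= r r0 rP]; exists (r / 2); first by rewrite divr_gt0.
move=> z zr; apply: rP; rewrite -ball_normE /= distrC.
by apply: le_lt_trans zr _; rewrite ltr_pdivrMr// ltr_pMr// ltr1n.
Qed.

(** A cone of height proportional to its radius in a chart around [x0].  Its
    slope is below the pinching constant of the metric, so it is
    [length_lipschitz]; in a Hausdorff space its support, the image of a closed
    coordinate ball, is closed, so that the extension by 0 is harmless. *)
Lemma exists_length_lipschitz_bump (x0 : M) (U : set M) :
  hausdorff_space M -> nbhs x0 U ->
  exists b : M -> R, [/\ length_lipschitz b, 0 < b x0,
    {for x0, continuous b} & forall y, 0 < b y -> U y].
Proof.
move=> hM Ux0; have d0 := chart_atP A x0; set i := chart_at A x0 in d0.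
pose z0 := crd i x0.
have iz0 : (crd i @` dom i) z0 by exists x0.
have [k k0 kz0] := gprod_pinch g iz0.
have Uz0 : \forall z \near z0, U (crdV i z).
  have C : crdV i z @[z --> z0] --> crdV i z0 := crdV_continuous iz0.
  by apply: (C U); rewrite crdK.
have [r r0 rP] := near_closed_ball (filterI (near_crd_image d0)
  (filterI kz0 Uz0)).
pose h z := k * Num.max 0 (r - `|z - z0|).
have h_far z : r <= `|z - z0| -> h z = 0.
  by move=> rz; rewrite /h max_l ?mulr0// subr_le0.
have h_lip z z' : `|h z' - h z| <= k * `|z' - z|.
  rewrite /h -mulrBr normrM gtr0_norm// ler_pM2l//.
  have := ler_dist_dist (z' - z0) (z - z0).
  rewrite (_ : z' - z0 - (z - z0) = z' - z); last first.
    by rewrite opprB addrA subrK.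
  rewrite !ler_norml => /andP[h1 h2].
  by case: (leP 0 (r - `|z' - z0|)); case: (leP 0 (r - `|z - z0|)); lra.
pose b y := if pselect (dom i y) then h (crd i y) else 0.
have bE y : dom i y -> b y = h (crd i y) by rewrite /b; case: pselect.
have bN y : ~ dom i y -> b y = 0 by rewrite /b; case: pselect.
exists b; split.
- move=> c s t st C1;
  apply: (@dist_le_Rintegral R (b \o c) _ _ _ st (speed_continuous C1)).
  move=> u ust e e0; have [cc Cc] := C1 u ust.
  have sp0 v : 0 <= (speed g c u + e) * `|v - u|.
    by rewrite mulr_ge0// addr_ge0 ?sqrtr_ge0// ltW.
  (* Off the chart domain, [b \o c] vanishes around [u]. *)
  have [du|ndu] := pselect (dom i (c u)); last first.
    pose K := crdV i @` [set z | `|z - z0| <= r].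
    have cK : closed K.
      apply: compact_closed => //; apply: continuous_compact; last first.
        apply: bounded_closed_compact.
          exists (`|z0| + r); split; first by rewrite num_real.
          move=> m m1 z /= zr; apply: ltW; apply: le_lt_trans m1.
          by rewrite -[z](subrK z0) addrC; apply: le_trans (ler_normD _ _) _;
             rewrite lerD2l.
        rewrite (_ : mkset _ = (fun z => `|z - z0|) @^-1` [set y | y <= r])//.
        apply: preimage_closed => [z _|]; last exact: closed_le.
        exact: (cvg_norm (cvgB (@cvg_id _ (nbhs z)) (cvg_cst z0))).
      apply/subspace_continuousP => z /rP[iz _].
      by apply: cvg_within_filter; exact: crdV_continuous.
    have nKu : (~` K) (c u).
      move=> [z /rP[[y dy <-] _]]; rewrite crdK// => yu.
      by apply: ndu; rewrite -yu.
    have : \forall v \near u, (~` K) (c v).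
      apply: (cc (~` K)); apply: open_nbhs_nbhs; split => //.
      exact: closed_openC.
    apply: filterS => v nKv _.
    suff bv : b (c v) = 0 by rewrite /= bv (bN _ ndu) subrr normr0.
    have [dv|] := pselect (dom i (c v)); last exact: bN.
    rewrite bE// h_far//; apply: ltW; rewrite ltNge; apply/negP => zr.
    by apply: nKv; exists (crd i (c v)); rewrite // crdK.
  have [dc _] := Cc i du.
  have dcu : derivable (crd i \o c) u 1 by exact: nbhs_singleton dc.
  have [zr|zr] := leP `|crd i (c u) - z0| r; last first.
    have : \forall v \near u, r < `|crd i (c v) - z0|.
      apply: (cvgr_gt _ (cvg_norm (cvgB (crd_comp_continuous cc du)
        (cvg_cst z0)))); exact: zr.
    apply: filterS2 (near_dom cc du) => v dv zvr _.
    by rewrite /= !bE// (h_far _ (ltW zr)) (h_far _ (ltW zvr)) subrr normr0.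
  have e1 : 0 < e / k by rewrite divr_gt0.
  apply: filterS2 (near_dom cc du) (derivable_lipschitz_at dcu e1).
  move=> v dv Lv _; rewrite /= !bE//.
  apply: le_trans (h_lip _ _) _.
  rewrite -ler_pdivlMl//; apply: le_trans Lv _.
  rewrite mulrA ler_wpM2r// mulrDr [_ * e]mulrC lerD2r.
  rewrite (speedE _ cc du dcu) ler_pdivlMl//.
  have [_ [kz _]] := rP _ zr.
  by have /andP[] := kz (derive1 (crd i \o c) u).
- by rewrite bE// /h -/z0 subrr normr0 subr0 mulr_gt0// lt_max r0 orbT.
- have h_cont : h z @[z --> z0] --> h z0.
    apply/(@cvgrPdist_lt _ _ _ (nbhs z0) _ h) => e e0.
    have ek : 0 < e / k by rewrite divr_gt0.
    apply/nbhs_ballP; exists (e / k) => // z; rewrite -ball_normE/= => zk.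
    by apply: le_lt_trans (h_lip _ _) _; rewrite -ltr_pdivlMl// mulrC.
  rewrite /prop_for/continuous_at bE//.
  have E : {near x0, h \o crd i =1 b}.
    apply: filterS (open_nbhs_nbhs (conj (dom_open i) d0)) => y dy.
    by rewrite bE.
  exact: (cvg_near_eq E (cvg_comp _ _ (crd_continuous d0) h_cont)).
- move=> y; have [dy|ndy] := pselect (dom i y); last by rewrite bN// ltxx.
  rewrite bE// => hy; rewrite -(crdK dy).
  have /rP[_ [_ //]] : `|crd i y - z0| <= r.
  rewrite leNgt; apply/negP => ry.
  by move: hy; rewrite h_far ?ltxx// ltW.
Qed.

Lemma is_derive_segment (W : normedModType R) (z0 w : W) t :
  is_derive t (1 : R) (fun s : R => z0 + s *: w) w.
Proof.
pose ze s := z0 + s *: w.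
have D : is_diff t ze (0 + ( *:%R^~ w)).
  have -> : ze = cst z0 + ( *:%R^~ w) by [].
  exact: is_diffD.
apply: DeriveDef; first by apply/derivable1_diffP; exact: ex_diff.
rewrite deriveE; last exact: ex_diff.
by rewrite (@diff_val _ _ _ _ _ _ _ D) /= fctE add0r scale1r.
Qed.

(** Read in a chart [j], the image of a segment under [crdV i] is that segment
    followed by the smooth map [trans i j]. *)
Lemma chart_segment_C1 i (z0 w : 'rV[R]_n) t :
  (crd i @` dom i) (z0 + t *: w) -> C1_at A (fun s => crdV i (z0 + s *: w)) t.
Proof.
move=> it; pose ze s := z0 + s *: w.
have cze s : {for s, continuous ze}.
  apply: cvgD; first exact: cvg_cst.
  by apply: cvgZl; exact: cvg_id.
have dze s : is_derive s (1 : R) ze w by exact: is_derive_segment.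
have cc : {for t, continuous (crdV i \o ze)}.
  exact: (cvg_comp _ _ (cze t) (crdV_continuous it)).
split=> // j dj.
pose V := crd i @` (dom i `&` dom j).
have Vt : \forall s \near t, V (ze s).
  have it' : \forall s \near t, (crd i @` dom i) (ze s).
    by apply: (cze t); apply: open_nbhs_nbhs; split => //; exact: crd_open.
  apply: filterS2 it' (near_dom cc dj) => s [y dy yE] /=.
  by rewrite -yE crdK// => djy; exists y.
have [dT CT] := trans_smooth i j 1%N.
have D s : V (ze s) -> derivable (trans i j \o ze) s 1 /\
    derive1 (trans i j \o ze) s = 'D_w (trans i j) (ze s).
  move=> Vs; have dTs := dT _ Vs.
  have dzs : differentiable ze s by apply/derivable1_diffP; case: (dze s).
  split; first by apply/derivable1_diffP; exact: differentiable_comp.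
  rewrite derive1E !deriveE//; last exact: differentiable_comp.
  by rewrite diff_comp//= -[in 'd ze s 1]deriveE// derive_val.
split; first by apply: filterS Vt => s /D[].
rewrite /prop_for/continuous_at.
have [_ ->] := D t (nbhs_singleton Vt).
have E : {near t, (fun s => 'D_w (trans i j) (ze s)) =1
    derive1 (trans i j \o ze)}.
  by apply: filterS Vt => s /D[_ ->].
have C := cvg_comp _ _ (cze t) (CT w _ (nbhs_singleton Vt)).
exact: (cvg_near_eq E C).
Qed.

End ShortCurves.

(** * Concatenation and reversal of paths *)

Section Paths.
Context (R : realType) (n' : nat) (M : ptopologicalType).
Local Notation n := n'.+1.
Variables (A : oriented_atlas R n M) (g : metric A).
Local Notation I := (chart_index A).
Local Notation mu := (@lebesgue_measure R).
Implicit Types (c : R -> M) (i j : I) (t : R).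

Lemma arc_length_le c a b k : a <= b ->
  (forall t, a <= t <= b -> C1_at A c t) ->
  (forall t, a <= t <= b -> speed g c t <= k) ->
  arc_length g c a b <= k * (b - a).
Proof.
by move=> ab C1 ck; apply: Rintegral_itv_le => //; exact: speed_continuous.
Qed.

(** Coordinate segments will do: the upper pinching constant bounds their
    lengths by their coordinate lengths. *)
Lemma near_short_curve x0 (U : set M) e : nbhs x0 U -> 0 < e ->
  \forall y \near x0, exists c : R -> M, [/\ c 0 = x0, c 1 = y,
    arc_length g c 0 1 < e &
    forall t, 0 <= t <= 1 -> C1_at A c t /\ U (c t)].
Proof.
move=> Ux0 e0; have d0 := chart_atP A x0; set i := chart_at A x0 in d0.
pose z0 := crd i x0.
have iz0 : (crd i @` dom i) z0 by exists x0.
have [k k0 kz0] := gprod_pinch g iz0.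
have Uz0 : \forall z \near z0, U (crdV i z).
  have C : crdV i z @[z --> z0] --> crdV i z0 := crdV_continuous iz0.
  by apply: (C U); rewrite crdK.
have [r r0 rP] := near_closed_ball (filterI (near_crd_image d0)
  (filterI kz0 Uz0)).
pose d := Num.min r (k * e / 2).
have de0 : 0 < d by rewrite lt_min r0 divr_gt0// mulr_gt0.
have near_z : \forall y \near x0, `|crd i y - z0| < d.
  have C : `|crd i y - z0| @[y --> x0] --> `|crd i x0 - z0|.
    exact: (cvg_norm (cvgB (crd_continuous d0) (cvg_cst z0))).
  by apply: (cvgr_lt _ C); rewrite subrr normr0.
have near_i := open_nbhs_nbhs (conj (dom_open i) d0).
apply: filterS2 near_i near_z => y dy.
set w := crd i y - z0 => wd.
have wr : `|w| <= r by apply: ltW (lt_le_trans wd _); rewrite ge_min lexx.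
pose c s := crdV i (z0 + s *: w).
have ball_t t : 0 <= t <= 1 -> `|z0 + t *: w - z0| <= r.
  move=> /andP[t0 t1]; rewrite addrAC subrr add0r normrZ ger0_norm//.
  by apply: le_trans wr; rewrite ler_piMl.
have C1 t : 0 <= t <= 1 -> C1_at A c t.
  by move=> /ball_t/rP[it _]; exact: chart_segment_C1.
exists c; split.
- by rewrite /c scale0r addr0 crdK.
- by rewrite /c scale1r addrC subrK crdK.
- have h : arc_length g c 0 1 <= k^-1 * `|w| * (1 - 0).
    apply: arc_length_le => // t t01; have /ball_t/rP[it [kt _]] := t01.
    have [cc Cc] := C1 t t01.
    have di : dom i (c t) by case: it => x dx xE; rewrite /c -xE crdK.
    have [dc _] := Cc i di.
    rewrite (speedE _ cc di (nbhs_singleton dc)).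
    have [_] := andP (kt w).
    have -> : crd i (c t) = z0 + t *: w.
      by case: it => x dx xE; rewrite /c -xE crdK.
    suff -> : derive1 (crd i \o c) t = w by [].
    have E : {near t, (fun s => z0 + s *: w) =1 crd i \o c}.
      have it' : \forall s \near t, (crd i @` dom i) (z0 + s *: w).
        have C : (z0 + s *: w) @[s --> t] --> z0 + t *: w.
          by apply: cvgD; [exact: cvg_cst|apply: cvgZl; exact: cvg_id].
        by apply: C; apply: open_nbhs_nbhs; split => //; exact: crd_open.
      by apply: filterS it' => s [x dx xE]; rewrite /c /= -xE crdK.
    rewrite derive1E -(near_eq_derive _ E).
    exact: (@derive_val _ _ _ _ _ _ _ (is_derive_segment z0 w t)).
  apply: le_lt_trans h _; rewrite subr0 mulr1 mulrC ltr_pdivrMr//.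
  apply: lt_le_trans wd _; rewrite ge_min; apply/orP; right.
  by have := mulr_gt0 k0 e0; lra.
- by move=> t t01; split; [exact: C1|have /ball_t/rP[_ []] := t01].
Qed.

Lemma derive1_opp (W : normedModType R) (f : R -> W) t :
  derivable f (- t) 1 ->
  derivable (f \o -%R) t 1 /\ derive1 (f \o -%R) t = - derive1 f (- t).
Proof.
move=> df.
have D : is_derive t (1 : R) (-%R : R -> R) (-1) by exact: is_deriveNid.
have dF : differentiable f ((-%R : R -> R) t) by apply/derivable1_diffP.
have dN : differentiable (-%R : R -> R) t by apply/derivable1_diffP; case: D.
have dfN := differentiable_comp dN dF.
split; first exact/derivable1_diffP.
have dN1 : 'd (-%R : R -> R) t 1 = - 1 by rewrite -deriveE// derive_val.
have E0 := diff_comp dN dF.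
have E : 'd (f \o -%R) t 1 = 'd f ((-%R : R -> R) t) ('d (-%R : R -> R) t 1).
  exact: (congr1 (fun h : R -> W => h 1) E0).
have E1 := deriveE (1 : R) dF; have E2 := deriveE (1 : R) dfN.
by rewrite !derive1E E2 E E1 dN1 linearN.
Qed.

Lemma cvg_opp t : (- s) @[s --> t] --> - t.
Proof. by apply: cvgN; exact: cvg_id. Qed.

Lemma near_opp (P : R -> Prop) t : (\forall s \near - t, P s) ->
  \forall s \near t, P (- s).
Proof. by move=> tP; exact: (@cvg_opp t P tP). Qed.

Lemma C1_at_opp c t : C1_at A c (- t) -> C1_at A (c \o -%R) t.
Proof.
move=> [cc Cc]; split; first exact: (cvg_comp _ _ (cvg_opp (t := t)) cc).
move=> i di; have [dc cdc] := Cc i di.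
have dc' : \forall s \near t, derivable (crd i \o c) (- s) 1.
  exact: (near_opp dc).
split; first by apply: filterS dc' => s /derive1_opp[].
have E : {near t, (fun s => - derive1 (crd i \o c) (- s)) =1
    derive1 (crd i \o (c \o -%R))}.
  by apply: filterS dc' => s /derive1_opp[_ /= ->].
rewrite /prop_for/continuous_at.
rewrite -(nbhs_singleton E).
exact: (cvg_near_eq E (cvgN (cvg_comp _ _ (cvg_opp (t := t)) cdc))).
Qed.

Lemma speed_opp c t : C1_at A c (- t) -> speed g (c \o -%R) t = speed g c (- t).
Proof.
move=> [cc Cc]; rewrite /speed /=.
have [dc _] := Cc _ (chart_atP A (c (- t))).
have [_] := derive1_opp (nbhs_singleton dc).
rewrite compA => ->; rewrite -(scaleN1r (derive1 _ _)) gprodZ.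
by rewrite sqrrN expr1n mul1r.
Qed.

Lemma arc_length_opp c a b : a <= b ->
  (forall t, a <= t <= b -> C1_at A c t) ->
  arc_length g (c \o -%R) (- b) (- a) = arc_length g c a b.
Proof.
move=> ab C1; rewrite /arc_length.
have -> : \int[mu]_(t in `[(- b), (- a)]) speed g (c \o -%R) t =
    \int[mu]_(t in `[(- b), (- a)]) (speed g c \o -%R) t.
  apply: eq_Rintegral => t; rewrite inE/= in_itv/= => tab.
  by rewrite speed_opp//; apply: C1; lra.
rewrite /Rintegral -(@integration_by_substitution_oppr R (speed g c)) ?lerN2//.
  by rewrite !opprK.
by rewrite !opprK; exact: speed_continuous.
Qed.

Section PathLength.
Context (X : topologicalType) (p : X -> M).
Implicit Types (x y z : X).

Lemma path_length_piece (a b : R) (c : R -> X) : a <= b ->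
  (forall t, a <= t <= b -> {for t, continuous c} /\ C1_at A (p \o c) t) ->
  path_length g p (c a) (c b) (arc_length g (p \o c) a b).
Proof.
move=> ab C1; rewrite -[arc_length _ _ _ _]addr0.
by apply: path_length_cons => //; exact: path_length_nil.
Qed.

Lemma path_length_ge0 x y l : path_length g p x y l -> 0 <= l.
Proof. by elim=> // a b c z k ab C1 _ k0; rewrite addr_ge0// arc_length_ge0. Qed.

Lemma path_length_trans x y z l l' :
  path_length g p x y l -> path_length g p y z l' -> path_length g p x z (l + l').
Proof.
move=> xy; elim: xy z l' => [w z l' |a b c w k ab C1 _ IH z l' wz].
  by rewrite add0r.
by rewrite -addrA; apply: path_length_cons => //; exact: IH.
Qed.

Lemma path_length_sym x y l : path_length g p x y l -> path_length g p y x l.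
Proof.
elim=> [w|a b c w k ab C1 _ IH]; first exact: path_length_nil.
rewrite addrC; apply: path_length_trans IH _.
rewrite -(arc_length_opp ab (fun t h => (C1 t h).2)).
have := @path_length_piece (- b) (- a) (c \o -%R); rewrite /= !opprK; apply.
  by rewrite lerN2.
move=> t tab; have [ct Ct] : {for - t, continuous c} /\ C1_at A (p \o c) (- t).
  by apply: C1; lra.
split; first exact: (cvg_comp _ _ (cvg_opp (t := t)) ct).
exact: (@C1_at_opp (p \o c)).
Qed.

End PathLength.

End Paths.

(** * Sheets of a covering *)

Definition evenly_covered_by (X Y : topologicalType) (p : X -> Y) (U : set Y)
    (J : Type) (s : J -> Y -> X) : Prop :=
  [/\ forall a, open (s a @` U),
      forall a z, U z -> p (s a z) = z /\ {for z, continuous (s a)},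
      trivIset setT (fun a => s a @` U) &
      p @^-1` U = \bigcup_a (s a @` U)].

Section EvenlyCovered.
Context (R : realType) (X Y : topologicalType) (p : X -> Y) (U : set Y).
Context (J : Type) (s : J -> Y -> X).
Hypothesis ecU : evenly_covered_by p U s.

Lemma sheetP x : U (p x) -> exists a, x = s a (p x).
Proof.
case: ecU => _ ps _ pU Upx.
have [a _ [z Uz zx]] : (\bigcup_a (s a @` U)) x by rewrite -pU.
by exists a; rewrite -zx (ps a z Uz).1.
Qed.

(** The sheets over [U] are open and disjoint, so the connected image of the
    curve meets only one of them. *)
Lemma curve_in_sheet (c : R -> X) (a b : R) (k : J) :
  (forall t, a <= t <= b -> {for t, continuous c} /\ U (p (c t))) ->
  c a = s k (p (c a)) -> forall t, a <= t <= b -> c t = s k (p (c t)).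
Proof.
move=> cU ca t0 t0ab; case: ecU => os ps ts pU.
have aab : a <= a <= b by lra.
have cC : connected (c @` `[a, b]).
  apply: connected_continuous_connected.
    by apply/connected_intervalP; exact: interval_is_interval.
  apply/subspace_continuousP => t /=; rewrite in_itv/= => tab.
  by apply: cvg_within_filter; have [] := cU t tab.
pose S := s k @` U; pose S' := \bigcup_(j in [set j | j <> k]) (s j @` U).
have oS' : open S' by apply: bigcup_open => j _; exact: os.
have cE : c @` `[a, b] `&` S = c @` `[a, b].
  apply: cC.
  - exists (c a); split; last by exists (p (c a)); [have [] := cU a aab|].
    by exists a => //=; rewrite in_itv.
  - by exists S; [exact: os|].
  - exists (~` S'); first exact: open_closedC.
    apply/seteqP; split=> _ [[t tab <-]]; rewrite /= in_itv/= in tab.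
      move=> Sct; split; first by exists t.
      move=> [j jk Sj]; apply: jk; apply: (ts j k) => //.
      by exists (c t).
    move=> nS'; split; first by exists t.
    have [_ Uct] := cU t tab; have [j cj] := sheetP Uct.
    have [jk|jk] := pselect (j = k).
      by exists (p (c t)); rewrite // -jk.
    by exfalso; apply: nS'; exists j => //; exists (p (c t)).
have : (c @` `[a, b] `&` S) (c t0).
  by rewrite cE; exists t0 => //=; rewrite in_itv.
by move=> [_ [z Uz zE]]; rewrite -zE (ps k z Uz).1.
Qed.

End EvenlyCovered.

Section PathsInCoverings.
Context (R : realType) (n' : nat) (M : ptopologicalType).
Local Notation n := n'.+1.
Variables (A : oriented_atlas R n M) (g : metric A).

(** A lift through a sheet over [U] projects back to the original curve only at
    the times, an open set, at which that curve is in [U]; hence the need for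
    locality. *)
Lemma near_eq_C1_at (c c' : R -> M) t : {near t, c =1 c'} ->
  C1_at A c t -> C1_at A c' t /\ speed g c' t = speed g c t.
Proof.
move=> cc' [cc Cc]; have ct := nbhs_singleton cc'.
have nn : \forall s \near t, {near s, c =1 c'} by exact/nbhs_interior.
have dE (i : chart_index A) :
    {near t, derive1 (crd i \o c) =1 derive1 (crd i \o c')}.
  apply: filterS nn => s sE; rewrite !derive1E; apply: near_eq_derive.
  by apply: filterS sE => u /= ->.
split; last first.
  rewrite /speed -ct (nbhs_singleton (dE _)).
  reflexivity.
split; first by rewrite /prop_for/continuous_at -ct; exact: (cvg_near_eq cc').
move=> i; rewrite -ct => di; have [dc cdc] := Cc i di.
split.
  apply: filterS2 nn dc => s sE ds.
  have sE' : {near s, crd i \o c =1 crd i \o c'}.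
    by apply: filterS sE => u /= ->.
  exact: (near_eq_derivable sE' ds).
rewrite /prop_for/continuous_at -(nbhs_singleton (dE i)).
exact: (cvg_near_eq (dE i)).
Qed.

Lemma arc_length_mono (c : R -> M) a t b : a <= t -> t <= b ->
  (forall u, a <= u <= b -> C1_at A c u) ->
  arc_length g c a t <= arc_length g c a b.
Proof.
move=> at_ tb C1; rewrite [leRHS]/arc_length (Rintegral_itv_split at_ tb).
  by rewrite lerDl; exact: arc_length_ge0.
exact: speed_continuous.
Qed.

Context (X : topologicalType) (p : X -> M).

Lemma length_lipschitz_path (b : M -> R) x y l : length_lipschitz g b ->
  path_length g p x y l -> `|b (p y) - b (p x)| <= l.
Proof.
move=> bL; elim=> [z|a a' c z k aa C1 _ IH]; first by rewrite subrr normr0.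
rewrite [leRHS]addrC; apply: le_trans (ler_distD (b (p (c a'))) _ _) _.
apply: lerD => //; exact: (bL (p \o c) _ _ aa (fun u h => (C1 u h).2)).
Qed.

Section Sheet.
Variables (U : set M) (oU : open U) (J : Type) (s : J -> M -> X).
Hypothesis ecU : evenly_covered_by p U s.

Lemma lift_curve (c : R -> M) a b k : a <= b ->
  (forall t, a <= t <= b -> C1_at A c t /\ U (c t)) ->
  path_length g p (s k (c a)) (s k (c b)) (arc_length g c a b).
Proof.
move=> ab cU; case: ecU => _ ps _ _.
have psE t : a <= t <= b -> {near t, c =1 p \o (s k \o c)}.
  move=> /cU[[cc _] Uct].
  have : \forall u \near t, U (c u).
    by apply: (cc U); apply: open_nbhs_nbhs.
  by apply: filterS => u Ucu /=; rewrite (ps k _ Ucu).1.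
have -> : arc_length g c a b = arc_length g (p \o (s k \o c)) a b.
  apply: eq_Rintegral => t; rewrite inE/= in_itv/= => tab.
  by have [_ ->] := near_eq_C1_at (psE t tab) (cU t tab).1.
apply: (@path_length_piece _ _ _ _ _ _ p a b (s k \o c)) => // t tab.
have [[cc Cc] Uct] := cU t tab; split.
  exact: (cvg_comp _ _ cc (ps k _ Uct).2).
by have [] := near_eq_C1_at (psE t tab) (conj cc Cc).
Qed.

Variable b : M -> R.
Hypotheses (bL : length_lipschitz g b) (bU : forall y, 0 < b y -> U y).

(** A curve shorter than the height of the bump at its origin cannot come down
    to the complement of [U]. *)
Lemma bump_along_piece (c : R -> M) a a' : a <= a' ->
  (forall t, a <= t <= a' -> C1_at A c t) ->
  arc_length g c a a' < b (c a) -> forall t, a <= t <= a' -> U (c t).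
Proof.
move=> aa C1 lb t /andP[at_ ta]; apply: bU.
have : `|b (c t) - b (c a)| <= arc_length g c a t.
  by apply: bL => // u uat; apply: C1; lra.
have := arc_length_mono at_ ta C1.
rewrite ler_norml => h /andP[h1 _]; lra.
Qed.

(** Short paths of [M] stay in [U], hence lift to every sheet, with the same
    length.  Conversely, by [path_in_sheet], short paths of the covering cannot
    change sheets. *)
Lemma lift_path x y l k : path_length g id x y l -> l < b x ->
  path_length g p (s k x) (s k y) l.
Proof.
elim=> [z|a a' c z m aa C1 pz IH] lb; first exact: path_length_nil.
have C1' t : a <= t <= a' -> C1_at A c t by move=> /C1[].
have m0 := path_length_ge0 pz.
have la : arc_length g c a a' < b (c a).
  by apply: le_lt_trans lb; rewrite lerDl.
apply: path_length_trans.
  apply: lift_curve => // t tab; split; first exact: C1'.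
  exact: (bump_along_piece aa C1' la).
apply: IH; have := bL aa C1'; rewrite ler_norml => /andP[h _].
have : arc_length g (id \o c) a a' = arc_length g c a a' by [].
lra.
Qed.

Lemma path_in_sheet x y l k : path_length g p x y l -> l < b (p x) ->
  x = s k (p x) -> y = s k (p y).
Proof.
elim=> [//|a a' c z m aa C1 pz IH] lb ca.
have C1' t : a <= t <= a' -> C1_at A (p \o c) t by move=> /C1[].
have m0 := path_length_ge0 pz.
have la : arc_length g (p \o c) a a' < b (p (c a)).
  by apply: le_lt_trans lb; rewrite lerDl.
apply: IH.
  have := bL aa C1'; rewrite ler_norml /= => /andP[h _]; lra.
apply: (curve_in_sheet ecU (a := a) (b := a')) => //; last by rewrite aa lexx.
move=> t tab; split; first by have [] := C1 t tab.
exact: (bump_along_piece aa C1' la).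
Qed.

End Sheet.
End PathsInCoverings.

(** * Riemannian distances on a covering *)

(** [M] covers itself, so that what holds for distances in coverings of [M]
    holds in [M]. *)
Lemma evenly_covered_id (Y : topologicalType) :
  evenly_covered_by (@id Y) setT (fun (_ : unit) (y : Y) => y).
Proof.
split.
- move=> _; rewrite (_ : [set _ | _ in _] = setT); first exact: openT.
  by apply/seteqP; split=> // y _; exists y.
- by move=> _ z _; split => //; exact: cvg_id.
- by move=> [] [].
- by apply/seteqP; split=> // y _; exists tt => //; exists y.
Qed.

Lemma covering_map_id (Y : topologicalType) : covering_map (@id Y).
Proof.
split; first by move=> y; exact: cvg_id.
split=> [y|y]; first by exists y.
exists setT; split=> //; first exact: openT.
by exists unit, (fun _ z => z); exact: evenly_covered_id.
Qed.

Section Distance.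
Context (R : realType) (n' : nat) (M : ptopologicalType).
Local Notation n := n'.+1.
Variables (A : oriented_atlas R n M) (g : metric A).
Context (X : topologicalType) (p : X -> M).
Local Notation d := (riem_dist g p).

Lemma has_inf_lengths x y (l : R) : path_length g p x y l ->
  has_inf [set l | path_length g p x y l].
Proof. by move=> xy; split; [exists l|exists 0 => k /path_length_ge0]. Qed.

Lemma riem_dist_ge0 x y : 0 <= d x y.
Proof.
rewrite /riem_dist; have [[l xy]|nxy] := pselect (exists l, path_length g p x y l).
  by apply: lb_le_inf; [exists l|move=> k /path_length_ge0].
rewrite (_ : [set l | _] = set0) ?inf0//.
by apply/seteqP; split=> // l xy; apply: nxy; exists l.
Qed.

Lemma riem_dist_le x y l : path_length g p x y l -> d x y <= l.
Proof. by move=> xy; apply: ge_inf => //; have [] := has_inf_lengths xy. Qed.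

Lemma riem_distxx x : d x x = 0.
Proof.
apply/eqP; rewrite eq_le riem_dist_ge0 andbT.
by apply: riem_dist_le; exact: path_length_nil.
Qed.

Lemma riem_dist_sym x y : d x y = d y x.
Proof.
by congr inf; apply/seteqP; split=> l; exact: path_length_sym.
Qed.

Hypothesis cov : covering_map p.

Lemma covering_evenly_covered (y : M) : exists U : set M, [/\ open U, U y &
  exists (J : Type) (s : J -> M -> X), evenly_covered_by p U s].
Proof. by case: cov => _ [_ /(_ y)]. Qed.

Lemma near_path x e : 0 < e ->
  \forall x' \near x, exists2 l, l < e & path_length g p x x' l.
Proof.
move=> e0; have [U [oU Upx [J [s ecU]]]] := covering_evenly_covered (p x).
have [k xk] := sheetP ecU Upx.
have pc : p x' @[x' --> x] --> p x by case: cov => + _; exact.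
have near_sheet : \forall x' \near x, (s k @` U) x'.
  apply: open_nbhs_nbhs; split; first by case: ecU.
  by exists (p x).
have := near_short_curve g (open_nbhs_nbhs (conj oU Upx)) e0.
move=> /pc near_c.
apply: filterS2 near_sheet near_c => x' [z Uz zx'] [c [c0 c1 lc cU]].
exists (arc_length g c 0 1) => //.
have := lift_curve g oU ecU k ler01 cU; rewrite c0 c1 -xk.
suff -> : s k (p x') = x' by [].
by case: ecU => _ ps _ _; rewrite -zx' (ps k z Uz).1.
Qed.

Lemma near_riem_dist x e : 0 < e -> \forall x' \near x, d x x' < e.
Proof.
move=> /(near_path x); apply: filterS => x' [l le /riem_dist_le].
by move=> /le_lt_trans; apply.
Qed.

Hypothesis conX : connected [set: X].

(** The points reachable from [x] form an open set, and so do the others: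
    short paths can be reversed. *)
Lemma path_exists x y : exists l, path_length g p x y l.
Proof.
pose S := [set z | exists l, path_length g p x z l].
suff : S y by [].
rewrite (_ : S = setT)//; apply: conX.
- by exists x; exists 0; exact: path_length_nil.
- exists S; last by rewrite setTI.
  rewrite openE => z [l xz]; have := near_path z ltr01.
  by apply: filterS => w [k _ zw]; exists (l + k); exact: path_length_trans zw.
- exists S; last by rewrite setTI.
  rewrite -(setCK S); apply: open_closedC.
  rewrite openE => z nSz; have := near_path z ltr01.
  apply: filterS => w [k _ zw] [l xw].
  by apply: nSz; exists (l + k); exact: (path_length_trans xw (path_length_sym zw)).
Qed.

(** The infimum defining the distance would be 0 if no path joined the points;
    [path_exists] rules this out. *)
Lemma riem_dist_lt x y e : d x y < e ->
  exists2 l, l < e & path_length g p x y l.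
Proof.
move=> de; have [l0 xy0] := path_exists x y.
have de' : 0 < e - d x y by rewrite subr_gt0.
have [l xy lt] := inf_adherent de' (has_inf_lengths xy0).
by exists l => //; move: lt; rewrite -/(d x y) addrC subrK.
Qed.

Lemma riem_dist_triangle y x z : d x z <= d x y + d y z.
Proof.
apply/ler_addgt0Pr => e e0; have e2 : 0 < e / 2 by rewrite divr_gt0.
have [l le xy] : exists2 l, l < d x y + e / 2 & path_length g p x y l.
  by apply: riem_dist_lt; rewrite ltrDl.
have [k ke yz] : exists2 l, l < d y z + e / 2 & path_length g p y z l.
  by apply: riem_dist_lt; rewrite ltrDl.
apply: le_trans (riem_dist_le (path_length_trans xy yz)) _; lra.
Qed.

End Distance.

Section UniformSheets.
Context (R : realType) (n' : nat) (M : ptopologicalType).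
Local Notation n := n'.+1.
Variables (A : oriented_atlas R n M) (g : metric A).
Hypotheses (hM : hausdorff_space M) (cM : compact [set: M]).
Hypothesis conM : connected [set: M].
Local Notation dM := (riem_distM g).

Lemma riem_distM_triangle y x z : dM x z <= dM x y + dM y z.
Proof. by apply: riem_dist_triangle => //; exact: covering_map_id. Qed.

Lemma near_riem_distM x e : 0 < e -> \forall y \near x, dM x y < e.
Proof. by apply: near_riem_dist; exact: covering_map_id. Qed.

Lemma bump_gt0 (b : M -> R) y z : length_lipschitz g b -> dM y z < b y -> 0 < b z.
Proof.
move=> bL /(riem_dist_lt (@covering_map_id M) conM)[l lb yz].
have := length_lipschitz_path bL yz.
rewrite ler_norml => /andP[h _]; lra.
Qed.

(** The path metric separates points from closed sets: a path out of [U] is at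
    least as long as the height of a bump supported in [U]. *)
Lemma riem_distM_ball x (U : set M) : nbhs x U ->
  exists2 e, 0 < e & forall y, dM x y < e -> U y.
Proof.
move=> Ux; have [b [bL b0 _ bU]] := exists_length_lipschitz_bump g hM Ux.
by exists (b x) => // y xy; apply: bU; exact: bump_gt0 xy.
Qed.

Lemma riem_distM_eq0 x y : dM x y = 0 -> x = y.
Proof.
move=> xy0; apply: contrapT => /eqP/(hausdorff_accessible hM)[U [oU Ux nUy]].
have [e e0 eU] := riem_distM_ball (open_nbhs_nbhs (conj oU (set_mem Ux))).
by move: nUy; rewrite inE; apply; apply: eU; rewrite xy0.
Qed.

Context (X : topologicalType) (p : X -> M).
Hypotheses (cov : covering_map p) (conX : connected [set: X]).
Local Notation dX := (riem_dist g p).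

(** [rho] is a Lebesgue number for the covering: every point of [M] lies at
    depth more than [rho] in an evenly covered set. *)
Definition uniform_sheets (rho : R) := forall y : M,
  exists (U : set M) (J : Type) (s : J -> M -> X) (b : M -> R),
  [/\ open U, evenly_covered_by p U s, length_lipschitz g b,
      forall z, 0 < b z -> U z & rho < b y].

(** Each point has a bump supported in an evenly covered neighbourhood; half its
    height serves for all nearby points, and [M] is compact. *)
Lemma exists_uniform_sheets : exists2 rho, 0 < rho & uniform_sheets rho.
Proof.
pose Q (e : R) y := exists (U : set M) (J : Type) (s : J -> M -> X) (b : M -> R),
  [/\ open U, evenly_covered_by p U s, length_lipschitz g b,
    forall z, 0 < b z -> U z & e < b y].
have H : \forall e \near (0 : R)^'+, [set: M] `<=` Q e.
  apply: ((compact_near_coveringP setT).1 cM) => y _.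
  have [U [oU Uy [J [s ecU]]]] := covering_evenly_covered cov y.
  have [b [bL b0 bc bU]] :=
    exists_length_lipschitz_bump g hM (open_nbhs_nbhs (conj oU Uy)).
  have b2 : 0 < b y / 2 by rewrite divr_gt0.
  have near_b : \forall y' \near y, b y / 2 < b y'.
    by apply: (cvgr_gt _ bc); rewrite ltr_pdivrMr// ltr_pMr// ltr1n.
  exists ([set y' | b y / 2 < b y'], [set e | e < b y / 2]).
    by split => //=; exact: nbhs_right_lt.
  move=> [y' e] /= [by' eb]; exists U, J, s, b; split => //.
  exact: lt_trans by'.
near (0 : R)^'+ => rho; exists rho.
  by near: rho; exact: nbhs_right_gt.
have K : [set: M] `<=` Q rho by near: rho; exact: H.
by move=> y; exact: K.
Unshelve. all: by end_near. Qed.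

Variable rho : R.
Hypothesis rhoP : uniform_sheets rho.

(** While it stays [rho]-close to its starting point, a curve stays over an
    evenly covered set and thus in one sheet, to which short paths of [M] between
    its endpoints lift. *)
Lemma curve_dist_le (c : R -> X) a b : a <= b ->
  (forall t, a <= t <= b -> {for t, continuous c} /\ dM (p (c a)) (p (c t)) < rho) ->
  dX (c a) (c b) <= dM (p (c a)) (p (c b)).
Proof.
move=> ab cC; have [U [J [s [f [oU ecU fL fU rf]]]]] := rhoP (p (c a)).
have inU z : dM (p (c a)) z < rho -> U z.
  by move=> zr; apply: fU; apply: bump_gt0 fL _; exact: lt_trans zr rf.
have aab : a <= a <= b by rewrite lexx.
have bab : a <= b <= b by rewrite lexx andbT.
have [k ck] := sheetP ecU (inU _ (cC a aab).2).
have cbk : c b = s k (p (c b)).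
  apply: (curve_in_sheet ecU (a := a) (b := b)) => // t tab.
  by have [? /inU] := cC t tab.
apply/ler_addgt0Pr => e e0.
have [l] : exists2 l, l < Num.min rho (dM (p (c a)) (p (c b)) + e) &
    path_length g id (p (c a)) (p (c b)) l.
  apply: (riem_dist_lt (@covering_map_id M) conM).
  by rewrite lt_min (cC b bab).2 ltrDl.
rewrite lt_min => /andP[lr le] pl; apply: le_trans (ltW le).
rewrite ck cbk; apply: riem_dist_le.
by apply: (lift_path oU ecU fL fU k pl); exact: lt_trans lr rf.
Qed.

Lemma lift_close_point x y : dM (p x) y < rho ->
  exists2 y', p y' = y & dX x y' <= dM (p x) y.
Proof.
move=> xy; have [U [J [s [f [oU ecU fL fU rf]]]]] := rhoP (p x).
have inU z : dM (p x) z < rho -> U z.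
  by move=> zr; apply: fU; apply: bump_gt0 fL _; exact: lt_trans zr rf.
have Ux : U (p x) by apply: inU; rewrite /riem_distM riem_distxx;
  apply: le_lt_trans (riem_dist_ge0 _ _ _ _) xy.
have [k xk] := sheetP ecU Ux.
exists (s k y); first by case: ecU => _ ps _ _; exact: (ps k y (inU _ xy)).1.
apply/ler_addgt0Pr => e e0.
have [l] : exists2 l, l < Num.min rho (dM (p x) y + e) &
    path_length g id (p x) y l.
  apply: (riem_dist_lt (@covering_map_id M) conM).
  by rewrite lt_min xy ltrDl.
rewrite lt_min => /andP[lr le] pl; apply: le_trans (ltW le).
rewrite [in X in dX X _]xk; apply: riem_dist_le.
by apply: (lift_path oU ecU fL fU k pl); exact: lt_trans lr rf.
Qed.

(** A path joining two points of a fibre changes sheets, and is therefore not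
    short. *)
Lemma close_points_eq x y : p x = p y -> dX x y < rho -> x = y.
Proof.
move=> pxy /(riem_dist_lt cov conX)[l lr xy].
have [U [J [s [f [oU ecU fL fU rf]]]]] := rhoP (p x).
have l0 := path_length_ge0 xy.
have Ux : U (p x) by apply: fU; lra.
have [k xk] := sheetP ecU Ux.
have := path_in_sheet ecU fL fU xy (lt_trans lr rf) xk.
by rewrite -pxy -xk.
Qed.

End UniformSheets.

(** * Lifting a homotopy along a geodesic *)

Section Homotopy.
Context (R : realType) (n' : nat) (M : ptopologicalType).
Local Notation n := n'.+1.
Variables (A : oriented_atlas R n M) (g1 g2 : metric A).
Hypotheses (hM : hausdorff_space M) (cM : compact [set: M]).
Hypothesis conM : connected [set: M].
Local Notation d1 := (riem_distM g1).
Local Notation d2 := (riem_distM g2).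
Local Notation I01 := (@unit_interval R).

(** Uniform continuity on the compact cylinder, in terms of two unrelated
    metrics on [M]; compactness is used through its formulation with filters,
    as [M] carries no uniform structure. *)
Lemma homotopy_uniformly_continuous (H : R * M -> M) e : 0 < e ->
  {within I01 `*` [set: M], continuous H} ->
  exists2 de, 0 < de & forall s s' y y', I01 s -> I01 s' ->
    `|s - s'| <= de -> d1 y y' <= de -> d2 (H (s, y)) (H (s', y')) < e.
Proof.
move=> e0 cH; pose K := I01 `*` [set: M].
have cK : compact K by apply: compact_setX => //; exact: segment_compact.
pose Q (de : R) (sy : R * M) := forall s' y', I01 s' ->
  `|sy.1 - s'| <= de -> d1 sy.2 y' <= de -> d2 (H sy) (H (s', y')) < e.
have HQ : \forall de \near (0 : R)^'+, K `<=` Q de.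
  apply: ((near_covering_withinP K).2 ((compact_near_coveringP K).1 cK)).
  move=> [s0 y0] Ksy0; have e2 : 0 < e / 2 by rewrite divr_gt0.
  have /subspace_continuousP/(_ _ Ksy0) cH0 := cH.
  have := cH0 _ (near_riem_distM g2 (H (s0, y0)) e2).
  move=> [[P B] /= [/nbhs_ballP[/= r r0 rP] By0] PB].
  have {}PB s y : I01 s -> `|s0 - s| < r -> B y ->
      d2 (H (s0, y0)) (H (s, y)) < e / 2.
    by move=> Is sr Byy; apply: (PB (s, y)); split => //=; exact: rP.
  have [b b0 bB] := riem_distM_ball g1 hM conM By0.
  have r2 : 0 < r / 2 by rewrite divr_gt0.
  have b2 : 0 < b / 2 by rewrite divr_gt0.
  pose m := Num.min (r / 2) (b / 2).
  have m0 : 0 < m by rewrite lt_min r2.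
  exists ([set sy : R * M | `|s0 - sy.1| < r / 2 /\ d1 y0 sy.2 < b / 2],
      [set de | de < m]).
    split => /=; last exact: nbhs_right_lt.
    exists (ball s0 (r / 2), [set y | d1 y0 y < b / 2]); last by move=> [s y] [].
    split => /=; [exact: nbhsx_ballx|exact: near_riem_distM].
  move=> [[s y] de] /= [[sr yb] dem] [/= Is _] s' y' Is' ss' yy'.
  move: dem; rewrite lt_min => /andP[der deb].
  have h1 : d2 (H (s0, y0)) (H (s, y)) < e / 2.
    by apply: PB => //; [lra|apply: bB; lra].
  have h2 : d2 (H (s0, y0)) (H (s', y')) < e / 2.
    apply: PB => //.
      by apply: le_lt_trans (ler_distD s _ _) _; lra.
    apply: bB; apply: le_lt_trans (riem_distM_triangle g1 conM y _ _) _; lra.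
  apply: le_lt_trans (riem_distM_triangle g2 conM (H (s0, y0)) _ _) _.
  by rewrite {1}/riem_distM riem_dist_sym; lra.
near (0 : R)^'+ => de; exists de; first by near: de; exact: nbhs_right_gt.
have KQ : K `<=` Q de by near: de; exact: HQ.
by move=> s s' y y' Is Is'; exact: (KQ (s, y)).
Unshelve. all: by end_near. Qed.

Context (X : topologicalType) (p : X -> M).
Hypotheses (cov : covering_map p) (conX : connected [set: X]).
Local Notation dX := (riem_dist g2 p).

Lemma chain_dist_le (x : nat -> X) k :
  dX (x 0%N) (x k) <= \sum_(j < k) dX (x j) (x j.+1).
Proof.
elim: k => [|k IH]; first by rewrite big_ord0 riem_distxx.
rewrite big_ord_recr/=.
by apply: le_trans (riem_dist_triangle g2 cov conX (x k) _ _) _; rewrite lerD2r.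
Qed.

(** Pushing a curve of the covering along a homotopy from the identity moves
    its points by at most half of [C], so that its endpoints are about as far
    apart as those of the lift of the image curve.  The homotopy is lifted on a
    grid so fine that every step, in time or along the curve, stays within the
    range where points lift uniquely; bounding the grid squares shows that the
    lifted rows are again chains of close points. *)
Lemma dist_le_image_chain (f : M -> M) : homotopic_to_id R f ->
  exists C : R, exists2 de0 : R, 0 < de0 & forall de, 0 < de -> de <= de0 ->
  forall c : R -> X, continuous c ->
    (forall s t, d1 (p (c s)) (p (c t)) <= `|s - t|) -> forall k : nat,
  dX (c 0) (c (k%:R * de)) <=
    C + \sum_(j < k) d2 (f (p (c (j%:R * de)))) (f (p (c (j.+1%:R * de)))).
Proof.
move=> [H [cH Hid]].
have [rho rho0 rhoP] := exists_uniform_sheets g2 hM cM cov.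
(* Four steps on the grid have to stay below [rho]. *)
pose eta := rho / 5; have eta0 : 0 < eta by rewrite divr_gt0.
have eta_rho z : z < eta -> z < rho by rewrite /eta; lra.
have [de0 de00 Hde] := homotopy_uniformly_continuous eta0 cH.
have [N Nde] : exists N : nat, N.+1%:R^-1 < de0.
  by have [N] := ltr_add_invr de00; rewrite add0r; exists N.
exists (N.+1%:R * eta * 2); exists de0 => // de de_gt0 dede0 c cc cL k.
pose q j := p (c (j%:R * de)).
have qL j : d1 (q j) (q j.+1) <= de0.
  apply: le_trans (cL _ _) _.
  rewrite -(natr1 j) mulrDl mul1r opprD addrA subrr add0r normrN.
  by rewrite gtr0_norm.
pose s (i : nat) : R := i%:R / N.+1%:R.
have sI i : (i <= N.+1)%N -> I01 (s i).
  move=> iN; rewrite /unit_interval /= in_itv /= divr_ge0//=.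
  by rewrite ler_pdivrMr ?ltr0n// mul1r ler_nat.
pose y i j := H (s i, q j).
have yi i j : (i < N.+1)%N -> d2 (y i j) (y i.+1 j) < eta.
  move=> iN; apply: Hde; [exact/sI/ltnW|exact: sI| |].
    rewrite /s -(natr1 i) mulrDl mul1r opprD addrA subrr add0r normrN.
    by rewrite ger0_norm ?invr_ge0// ltW.
  by rewrite /riem_distM riem_distxx ltW.
have yj i j : (i <= N.+1)%N -> d2 (y i j) (y i j.+1) < eta.
  by move=> iN; apply: Hde; [exact: sI|exact: sI|rewrite subrr normr0 ltW|].
(* Row [i] lifts the image of the curve at time [s i] of the homotopy. *)
have rows i : (i <= N.+1)%N -> exists e : nat -> X, forall j,
    [/\ p (e j) = y i j, dX (e j) (e j.+1) <= d2 (y i j) (y i j.+1) &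
        dX (c (j%:R * de)) (e j) <= i%:R * eta].
  elim: i => [_|i IH iN].
    exists (fun j => c (j%:R * de)) => j.
    have y0 j' : y 0%N j' = q j'.
      by rewrite /y /s mul0r; have [-> _] := Hid (q j').
    rewrite !y0 riem_distxx mul0r; split => //.
    apply: (curve_dist_le conM rhoP).
      by rewrite ler_pM2r// ler_nat.
    move=> t tj; split; first exact: cc.
    apply: eta_rho; have [<- _] := Hid (p (c (j%:R * de))).
    have [<- _] := Hid (p (c t)).
    have I0 : I01 0 by rewrite /unit_interval /= in_itv /= lexx ler01.
    apply: Hde => //; first by rewrite subrr normr0 ltW.
    apply: le_trans (cL _ _) _; rewrite distrC ger0_norm; last lra.
    by move: tj; rewrite -(natr1 j) mulrDl mul1r; lra.
  have [e eP] := IH (ltnW iN).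
  have yi' j : d2 (p (e j)) (y i.+1 j) < rho.
    by have [-> _ _] := eP j; apply: eta_rho; exact: yi.
  have [e' e'P] := choice (fun j =>
    let: ex_intro2 x' h1 h2 := lift_close_point conM rhoP (yi' j) in
    ex_intro (fun x' => p x' = y i.+1 j /\ dX (e j) x' <= d2 (p (e j)) (y i.+1 j))
      x' (conj h1 h2)).
  have ee' j : dX (e j) (e' j) < eta.
    have [_ h] := e'P j; apply: le_lt_trans h _.
    by have [-> _ _] := eP j; exact: yi.
  exists e' => j; have [pe' _] := e'P j; split => //.
    have yj' : d2 (p (e' j)) (y i.+1 j.+1) < rho.
      by rewrite pe'; apply: eta_rho; exact: yj.
    have [z pz dz] := lift_close_point conM rhoP yj'.
    rewrite pe' in dz.
    (* [z] lifts the same point as [e' j.+1] and is joined to it by the other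
       three sides of the square and the step from [e' j] to [z]. *)
    suff <- : z = e' j.+1 by [].
    apply: (close_points_eq cov conX rhoP).
      by rewrite pz; have [-> _] := e'P j.+1.
    have h1 : dX z (e' j) < eta.
      by rewrite riem_dist_sym; apply: le_lt_trans dz _; exact: yj.
    have h2 : dX (e' j) (e j) < eta by rewrite riem_dist_sym.
    have h3 : dX (e j) (e j.+1) < eta.
      by have [_ h _] := eP j; apply: le_lt_trans h _; apply: yj; exact: ltnW.
    have h4 := ee' j.+1.
    have t1 := riem_dist_triangle g2 cov conX (e' j) z (e' j.+1).
    have t2 := riem_dist_triangle g2 cov conX (e j) (e' j) (e' j.+1).
    have t3 := riem_dist_triangle g2 cov conX (e j.+1) (e j) (e' j.+1).
    by move: h1 h2 h3 h4; rewrite /eta; lra.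
  have [_ _ h] := eP j.
  apply: le_trans (riem_dist_triangle g2 cov conX (e j) _ _) _.
  by rewrite -(natr1 i) mulrDl mul1r lerD// ltW.
have [e eP] := rows N.+1 (leqnn _).
have yE j : y N.+1 j = f (q j).
  by rewrite /y /s divff ?pnatr_eq0//; have [_ ->] := Hid (q j).
have [_ _ h0] := eP 0%N; have [_ _ hk] := eP k; rewrite mul0r in h0.
have hch := chain_dist_le e k.
have hsum : \sum_(j < k) dX (e j) (e j.+1) <=
    \sum_(j < k) d2 (f (q j)) (f (q j.+1)).
  by apply: ler_sum => j _; have [_ h _] := eP j; rewrite -!yE.
have t1 := riem_dist_triangle g2 cov conX (e 0%N) (c 0) (c (k%:R * de)).
have t2 := riem_dist_triangle g2 cov conX (e k) (e 0%N) (c (k%:R * de)).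
rewrite (riem_dist_sym g2 p (e k)) in t2.
by rewrite /q in hsum; lra.
Qed.

End Homotopy.

Section UnitSpeed.
Context (R : realType) (n' : nat) (M : ptopologicalType).
Local Notation n := n'.+1.
Variables (A : oriented_atlas R n M) (g : metric A).
Variable phi : R -> unit_tangent g -> unit_tangent g.
Hypothesis flow_phi : is_geodesic_flow phi.

Lemma orbit_C1 v t : C1_at A (orbit_foot phi v) t.
Proof.
have [_ _ _ /(_ v)[[cv gv] _]] := flow_phi; split; first exact: cv.
move=> i di; have [dc dc' _] := gv t i di; split; first exact: dc.
exact/differentiable_continuous/derivable1_diffP.
Qed.

Lemma orbit_speed v t : speed g (orbit_foot phi v) t = 1.
Proof.
have [_ _ _ /(_ v)[_ dv]] := flow_phi.
have dt := chart_atP A (orbit_foot phi v t).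
by rewrite /speed dv// vec_unit// sqrtr1.
Qed.

Lemma orbit_dist_le v s t :
  riem_distM g (orbit_foot phi v s) (orbit_foot phi v t) <= `|s - t|.
Proof.
wlog st : s t / s <= t => [wl|].
  have [/wl//|/ltW/wl] := leP s t.
  by rewrite /riem_distM riem_dist_sym distrC.
rewrite distrC ger0_norm ?subr_ge0// -[leRHS]mul1r.
have pl : path_length g id (orbit_foot phi v s) (orbit_foot phi v t)
    (arc_length g (orbit_foot phi v) s t).
  apply: (@path_length_piece _ _ _ _ _ _ id s t (orbit_foot phi v)) => // u _.
  by split; [case: (orbit_C1 v u)|exact: orbit_C1].
apply: le_trans (riem_dist_le pl) _; apply: arc_length_le => // u _.
  exact: orbit_C1.
by rewrite orbit_speed.
Qed.

End UnitSpeed.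

(** * Time averages *)

Section TimeAverages.
Local Open Scope ereal_scope.
Context (R : realType).

Lemma lim_le_limn_einf (u v : (\bar R)^nat) l : v @ \oo --> l ->
  (forall k, v k <= u k) -> l <= limn_einf u.
Proof.
move=> vl vu; rewrite limn_einf_lim.
have <- : limn (einfs v) = l by apply/cvg_lim => //; exact: cvg_einfs.
apply: lee_lim; [exact: is_cvg_einfs|exact: is_cvg_einfs|].
near=> k; apply: le_ereal_inf_tmp => _ [j /= kj <-].
by apply: le_trans (vu j); apply: ereal_inf_lbound; exists j.
Unshelve. all: by end_near. Qed.

Context d (T : measurableType d).

(** The integral of a nonnegative function is a supremum over the simple
    functions below it, hence monotone even without measurability. *)
Lemma ge0_integral_le_any (mu : {measure set T -> \bar R}) (f h : T -> \bar R) :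
  (forall x, 0 <= f x) -> (forall x, f x <= h x) ->
  \int[mu]_x f x <= \int[mu]_x h x.
Proof.
move=> f0 fh; have h0 x : 0 <= h x by exact: le_trans (f0 x) (fh x).
rewrite !ge0_integralTE//; apply: ereal_sup_le => _ [s sf <-].
by exists s => // x; exact: le_trans (sf x) (fh x).
Qed.

Variables (m : probability T R) (E : nat -> set T) (e : R).
Hypotheses (mE : forall j, measurable (E j)) (mEe : forall j, m (E j) = e%:E).
Variables (C a b : R).
Hypotheses (C0 : (0 <= C)%R) (a0 : (0 <= a)%R) (b0 : (0 <= b)%R).

Let avg (k : nat) (x : T) : \bar R :=
  (C / k.+1%:R + a)%:E + (b / k.+1%:R)%:E * \sum_(j < k.+1) (\1_(E j) x)%:E.

Lemma integral_time_average k :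
  \int[m]_x avg k x = (C / k.+1%:R + a + b * e)%:E.
Proof.
have mI j : measurable_fun [set: T] (EFin \o \1_(E j) : T -> \bar R).
  by apply/measurable_EFinP; exact: measurable_indic.
have I0 (j : nat) x : 0 <= (\1_(E j) x)%:E :> \bar R by rewrite lee_fin.
have k0 : (0 <= b / k.+1%:R)%R by rewrite divr_ge0.
have c0 : (0 <= C / k.+1%:R + a)%R by rewrite addr_ge0// divr_ge0.
have Ij j : \int[m]_x (\1_(E j) x)%:E = e%:E.
  by rewrite integral_indic// setIT; exact: mEe.
pose S x := \sum_(j < k.+1) (\1_(E j) x)%:E : \bar R.
have mS : measurable_fun setT S by apply: emeasurable_sum => j; exact: mI.
have S0 x : setT x -> 0 <= S x by move=> _; exact: sume_ge0.
have mbS : measurable_fun setT (fun x => (b / k.+1%:R)%:E * S x).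
  exact: measurable_funeM.
have bS0 x : setT x -> 0 <= (b / k.+1%:R)%:E * S x.
  by move=> _; rewrite mule_ge0 ?lee_fin// S0.
rewrite /avg (@ge0_integralD _ _ _ m setT measurableT (cst _) _ _ _ bS0 mbS)//.
rewrite integral_cst// [X in _ * X]probability_setT mule1.
rewrite (ge0_integralZl m measurableT mS S0) ?lee_fin//.
rewrite (@ge0_integral_sum _ _ _ m setT measurableT _ (fun j : 'I_k.+1 => _)
  (fun j => mI j) (fun j x _ => I0 j x)).
under eq_bigr => j _ do rewrite Ij.
rewrite sumEFin sumr_const card_ord -EFinM -EFinD; congr (_ + _)%:E.
by rewrite -[(e *+ _)%R]mulr_natl mulrA divfK// pnatr_eq0.
Qed.

(** Only an upper bound on the integral of the limit is needed, so Fatou's lemma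
    replaces the ergodic theorem.  The alternative [F x = 0] is for the points
    at which a limit fails to exist. *)
Lemma integral_le_time_average (F : T -> R) :
  (forall x, 0 <= F x)%R ->
  (forall x, F x = 0%R \/ exists2 u : R^nat, u @ \oo --> F x &
     forall k, (u k <= C / k.+1%:R + a
                + b / k.+1%:R * \sum_(j < k.+1) \1_(E j) x)%R) ->
  \int[m]_x (F x)%:E <= (a + b * e)%:E.
Proof.
move=> F0 Fu.
have avgE k x : avg k x = (C / k.+1%:R + a
    + b / k.+1%:R * \sum_(j < k.+1) \1_(E j) x)%:E.
  by rewrite /avg sumEFin -EFinM -EFinD.
have avg_ge0 k x : 0 <= avg k x.
  rewrite avgE lee_fin addr_ge0 ?addr_ge0 ?divr_ge0// mulr_ge0 ?divr_ge0//.
  exact: sumr_ge0.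
have mavg k : measurable_fun setT (avg k).
  apply: emeasurable_funD => //; apply: measurable_funeM.
  apply: emeasurable_sum => j.
  by apply/measurable_EFinP; exact: measurable_indic.
have step1 : \int[m]_x (F x)%:E <= \int[m]_x limn_einf (avg ^~ x).
  apply: ge0_integral_le_any => [x|x]; first by rewrite lee_fin.
  have [->|[u uF uk]] := Fu x.
    by apply: (@lim_le_limn_einf _ (fun=> 0)) => //; exact: cvg_cst.
  apply: (@lim_le_limn_einf _ (EFin \o u)).
    by apply: cvg_EFin => //; exact: nearW.
  by move=> k; rewrite avgE lee_fin.
apply: (le_trans step1); apply: (le_trans (fatou m measurableT mavg _)) => //.
under eq_fun do rewrite integral_time_average.
have lim : (fun k : nat => (C / k.+1%:R + a + b * e)%:E) @ \oo --> (a + b * e)%:E.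
  apply: cvg_EFin; first exact: nearW.
  rewrite -[X in _ --> X]add0r -(mulr0 C).
  under eq_fun do rewrite -addrA.
  apply: cvgD; last exact: cvg_cst.
  by apply: cvgM; [exact: cvg_cst|exact: cvg_harmonic].
by have [-> _] := cvg_limn_einf_sup lim.
Qed.

End TimeAverages.

(** * Geodesic stretch against Lipschitz constants *)

Lemma simply_connected_connected (R : realType) (X : topologicalType) (x : X) :
  simply_connected R X -> connected [set: X].
Proof.
move=> [pc _].
have [c cP] := choice (pc x).
have I0 : (@unit_interval R) 0 by rewrite /unit_interval /= in_itv /= lexx ler01.
have I1 : (@unit_interval R) 1 by rewrite /unit_interval /= in_itv /= lexx ler01.
have -> : [set: X] = \bigcup_(y in [set: X]) (c y @` @unit_interval R).
  apply/seteqP; split=> // y _; exists y => //; exists 1 => //.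
  by have [_ _] := cP y.
apply: bigcup_connected.
  by exists x => y _; exists 0 => //; have [] := cP y.
move=> y _; apply: connected_continuous_connected; last by have [] := cP y.
by apply/connected_intervalP; exact: interval_is_interval.
Qed.

Section Lipschitz.
Context (R : realType) (n' : nat) (M : ptopologicalType).
Local Notation n := n'.+1.
Variables (A : oriented_atlas R n M) (g1 g2 : metric A).
Local Notation d1 := (riem_distM g1).
Local Notation d2 := (riem_distM g2).
Hypotheses (hM : hausdorff_space M) (conM : connected [set: M]).
Implicit Types (f : M -> M) (D : set M).

(** The quotients defining [lip_on] bound the distance of the images because
    distinct points have positive distance. *)
Lemma lip_on_le D f K y y' : (lip_on g1 g2 D f <= K%:E)%E -> D y -> D y' ->
  d2 (f y) (f y') <= K * d1 y y'.
Proof.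
move=> fK Dy Dy'; have [->|yy'] := pselect (y = y').
  by rewrite /riem_distM !riem_distxx mulr0.
have d1_gt0 : 0 < d1 y y'.
  rewrite lt_neqAle riem_dist_ge0 andbT eq_sym; apply/eqP => /riem_distM_eq0.
  by move=> /(_ hM conM).
rewrite -ler_pdivrMr// -lee_fin; apply: le_trans fK.
by apply: ereal_sup_ubound; exists y, y'.
Qed.

Lemma local_lip_le_lip x f : (local_lip g1 g2 x f <= lip g1 g2 f)%E.
Proof.
apply: (@le_trans _ _ (lip_on g1 g2 [set y | d1 x y <= 1] f)).
  by apply: ereal_inf_lbound; exists 1 => //=.
apply: ereal_sup_le => _ [y [y' [_ _ yy' ->]]].
by exists y, y'.
Qed.

Lemma lip_on_ge0 D f y y' : D y -> D y' -> y <> y' ->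
  (0 <= lip_on g1 g2 D f)%E.
Proof.
move=> Dy Dy' yy'.
apply: (@le_trans _ _ (d2 (f y) (f y') / d1 y y')%:E).
  by rewrite lee_fin divr_ge0 ?riem_dist_ge0.
by apply: ereal_sup_ubound; exists y, y'.
Qed.

End Lipschitz.

Section UnitTangentBundle.
Context (R : realType) (n' : nat) (M : ptopologicalType).
Local Notation n := n'.+1.
Variables (A : oriented_atlas R n M) (g : metric A).
Local Notation SM := (unit_tangent g).

Lemma open_foot_preimage (O : set M) : open O -> open (@foot _ _ _ _ g @^-1` O).
Proof.
move=> oO; suff : ut_open (@foot _ _ _ _ g @^-1` O) by [].
move=> v Ov i dv.
have iv : (crd i @` dom i) (crd i (foot v)) by exists (foot v).
have C : crdV i z.1 @[z --> (crd i (foot v), vec v i)] -->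
    crdV i (crd i (foot v)).
  apply: (@cvg_comp _ _ _ fst (crdV i) _ (nbhs (crd i (foot v)))).
    exact: cvg_fst.
  exact: crdV_continuous iv.
rewrite crdK// in C.
have CO : \forall z \near (crd i (foot v), vec v i), O (crdV i z.1).
  exact: (C O (open_nbhs_nbhs (conj oO Ov))).
apply: filterS CO => z Oz w dw wz.
by move: Oz; rewrite -wz /= crdK.
Qed.

Variable phi : R -> SM -> SM.
Hypothesis flow_phi : is_geodesic_flow phi.

Lemma open_flow_preimage t (B : set SM) : open B -> open (phi t @^-1` B).
Proof.
have [_ _ cphi _] := flow_phi.
move=> oB; apply: open_comp oB => v _.
have CP : (t, w) @[w --> v] --> (t, v).
  exact: (cvg_pair (cvg_cst t) (@cvg_id _ (nbhs v))).
exact: (cvg_comp _ (fun z : R * SM => phi z.1 z.2) CP (cphi (t, v))).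
Qed.

(** A curve of speed 1 cannot be constant on an interval.  Hence balls contain
    two points, and the Lipschitz constants on them are suprema of nonempty
    sets. *)
Lemma orbit_moves (v : SM) r : 0 < r ->
  exists2 y, riem_distM g (foot v) y <= r & foot v <> y.
Proof.
move=> r0; have [phi0 _ _ /(_ v)[_ dv]] := flow_phi.
apply: contrapT => stuck.
have const t : `|t| <= r -> orbit_foot phi v t = foot v.
  move=> tr; apply: contrapT => ne; apply: stuck.
  exists (orbit_foot phi v t); last by move=> e; apply: ne.
  have {1}-> : foot v = orbit_foot phi v 0 by rewrite /orbit_foot phi0.
  apply: le_trans (orbit_dist_le flow_phi v 0 t) _.
  by rewrite sub0r normrN.
have d0 : dom (chart_at A (foot v)) (foot (phi 0 v)).
  by rewrite phi0; exact: chart_atP.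
have dE := dv 0 _ d0.
have E : {near (0 : R), crd (chart_at A (foot v)) \o orbit_foot phi v =1
    cst (crd (chart_at A (foot v)) (foot v))}.
  apply/nbhs_ballP; exists r => // t; rewrite -ball_normE /= sub0r normrN.
  by move=> /ltW /const ->.
rewrite derive1E (near_eq_derive _ E) derive_cst in dE.
have := vec_unit d0; rewrite -dE /gprod mul0mx mul0mx mxE => /eqP.
by rewrite eq_sym oner_eq0.
Qed.

End UnitTangentBundle.

Section Stretch.
Context (R : realType) (n' : nat) (M : ptopologicalType).
Local Notation n := n'.+1.
Variables (A : oriented_atlas R n M) (g1 g2 : metric A).
Hypotheses (hM : hausdorff_space M) (cM : compact [set: M]).
Hypothesis conM : connected [set: M].
Local Notation SM := (unit_tangent g1).
Local Notation borelSM := (g_sigma_algebraType (@open SM)).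
Variable phi : R -> SM -> SM.
Hypothesis flow_phi : is_geodesic_flow phi.
Context (X : topologicalType) (p : X -> M).
Hypotheses (cov : covering_map p) (conX : connected [set: X]).
Variable lft : SM -> R -> X.
Hypothesis lift_lft : forall v, is_lift p (orbit_foot phi v) (lft v).

Lemma open_borel (B : set SM) : open B -> measurable (B : set borelSM).
Proof. by move=> oB; exact: sub_sigma_algebra. Qed.

(** The key estimate.  If [f] is [L]-Lipschitz, and [K]-Lipschitz on a ball
    around [x] with [K < L], an invariant measure [m] pays for each visit of a
    geodesic near [x]: its stretch falls short of [L] by at least [L - K] times
    the mass over a neighbourhood [O] of [x]. *)
Lemma geodesic_stretch_le (f : M -> M) (m : probability borelSM R) (x : M)
    (r K L : R) :
  homotopic_to_id R f -> flow_invariant phi m ->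
  0 < r -> 0 <= K -> K <= L ->
  (lip_on g1 g2 [set y | (riem_distM g1 x y <= r)%R] f <= K%:E)%E ->
  (lip g1 g2 f <= L%:E)%E ->
  forall O : set M, open O -> (forall y, O y -> riem_distM g1 x y < r / 2) ->
  (geodesic_stretch g2 p lft m <=
    (K + (L - K) * fine (m (~` (@foot _ _ _ _ g1 @^-1` O))))%:E)%E.
Proof.
move=> fid inv r0 K0 KL lipK lipL O oO Or.
have [C [de0 de00 chain]] := dist_le_image_chain g1 g2 hM cM conM cov conX fid.
(* A step from [O] of length at most [r / 2] stays in the ball of radius [r]. *)
pose de := Num.min de0 (r / 2).
have de_gt0 : 0 < de by rewrite lt_min de00 divr_gt0.
have de_de0 : de <= de0 by rewrite ge_min lexx.
have de_r : de <= r / 2 by rewrite ge_min lexx orbT.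
pose B := @foot _ _ _ _ g1 @^-1` O.
have oB : open B by exact: open_foot_preimage.
pose t (j : nat) := j%:R * de.
pose E j : set borelSM := ~` (phi (t j) @^-1` B).
have oE j : open (phi (t j) @^-1` B) by exact: open_flow_preimage.
have mE j : measurable (E j) by apply: measurableC; exact: open_borel.
have mEe j : m (E j) = (fine (m (~` B)))%:E.
  have mB : measurable (~` B : set borelSM).
    by apply: measurableC; exact: open_borel.
  rewrite fineK ?fin_num_measure// -(inv (t j) _ mB).
  by rewrite preimage_setC.
pose C' := Num.max 0 C / de.
have C'0 : 0 <= C' by rewrite divr_ge0 ?(ltW de_gt0)// le_max lexx.
have LK0 : 0 <= L - K by rewrite subr_ge0.
rewrite /geodesic_stretch.
apply: (integral_le_time_average mE mEe C'0 K0 LK0).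
  move=> v; have [cv|ncv] := pselect (cvg
      (riem_dist g2 p (lft v 0) (lft v s) / s @[s --> +oo])); last first.
    by rewrite (dvgP ncv).
  apply: limr_ge; first exact: cv.
  near=> s; apply: divr_ge0; first exact: riem_dist_ge0.
  by near: s; exact: nbhs_pinfty_ge.
move=> v; have [cv|ncv] := pselect (cvg
    (riem_dist g2 p (lft v 0) (lft v s) / s @[s --> +oo])); last first.
  by left; rewrite (dvgP ncv).
right; exists (fun k => riem_dist g2 p (lft v 0) (lft v (t k.+1)) / t k.+1).
  have toy : t k.+1 @[k --> \oo] --> +oo.
    apply/cvgryPge => z; near=> k; rewrite /t -ler_pdivrMr//.
    apply: (@le_trans _ _ k%:R); last by rewrite ler_nat.
    by near: k; exact: nbhs_infty_ger.
  exact: (cvg_comp _ _ toy cv).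
move=> k; have [clv plv] := lift_lft v.
have tk0 : 0 < t k.+1 by rewrite mulr_gt0.
have clip s s' : riem_distM g1 (p (lft v s)) (p (lft v s')) <= `|s - s'|.
  by rewrite !plv; exact: orbit_dist_le.
have step j : riem_distM g2 (f (p (lft v (t j)))) (f (p (lft v (t j.+1)))) <=
    de * (K + (L - K) * \1_(E j) v).
  have dj : riem_distM g1 (p (lft v (t j))) (p (lft v (t j.+1))) <= de.
    apply: le_trans (clip _ _) _.
    rewrite /t -(natr1 j) mulrDl mul1r opprD addrA subrr add0r normrN.
    by rewrite gtr0_norm.
  rewrite indicE; have [Oj|nOj] := pselect (O (foot (phi (t j) v))).
    have -> : (v \in E j) = false by apply/negP; rewrite inE; apply.
    rewrite mulr0 addr0 mulrC.
    have bj : riem_distM g1 x (p (lft v (t j))) < r / 2.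
      by rewrite plv; exact: Or.
    apply: le_trans (lip_on_le hM conM lipK _ _) _ => /=.
    - by apply: ltW; apply: lt_le_trans bj _; rewrite ler_pdivrMr// ler_pMr// ler1n.
    - have := riem_distM_triangle g1 conM (p (lft v (t j))) x (p (lft v (t j.+1))).
      lra.
    - by rewrite ler_wpM2l.
  have -> : v \in E j by rewrite inE.
  rewrite mulr1 addrC subrK mulrC.
  apply: le_trans (lip_on_le hM conM lipL _ _) _ => //.
  by rewrite ler_wpM2l// (le_trans K0).
have := chain de de_gt0 de_de0 (lft v) clv clip k.+1.
rewrite -/(t k.+1) => ch.
have C_le : C <= C' * de by rewrite divfK ?gt_eqF// le_max lexx orbT.
have sum_le : \sum_(j < k.+1) riem_distM g2 (f (p (lft v (t j))))
    (f (p (lft v (t j.+1)))) <=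
    de * (K * k.+1%:R + (L - K) * \sum_(j < k.+1) \1_(E j) v).
  apply: (@le_trans _ _ (\sum_(j < k.+1) de * (K + (L - K) * \1_(E j) v))).
    by apply: ler_sum => j _; exact: step.
  rewrite -mulr_sumr big_split /= sumr_const card_ord -mulr_sumr.
  by rewrite mulr_natr.
rewrite ler_pdivrMr//; apply: le_trans ch _; apply: le_trans (lerD C_le sum_le) _.
set S := \sum_(j < k.+1) _; rewrite /t.
have : k.+1%:R != 0 :> R by rewrite pnatr_eq0.
move: (k.+1%:R : R) => N N0.
rewrite (_ : _ * (N * de) = C' * de + de * (K * N + (L - K) * S))//.
by field.
Unshelve. all: by end_near. Qed.

End Stretch.

Theorem theorem6 (R : realType) (n : nat)
  (M : ptopologicalType) (A : oriented_atlas R n.+2 M)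
  (hausdorffM : hausdorff_space M) (second_countableM : @second_countable M)
  (compactM : compact [set: M]) (connectedM : connected [set: M])
  (g1 g2 : metric A)
  (neg1 : negatively_curved g1) (neg2 : negatively_curved g2)
  (phi : R -> unit_tangent g1 -> unit_tangent g1)
  (flow_phi : is_geodesic_flow phi)
  (X : topologicalType) (p : X -> M) (univ_p : universal_covering R p)
  (lft : unit_tangent g1 -> R -> X)
  (lift_lft : forall v, is_lift p (orbit_foot phi v) (lft v))
  (stretch_eq_lip : max_stretch g2 phi p lft = least_lip g1 g2) :
  @foot _ _ _ _ g1 @` mather_set g2 phi p lft `<=` stretch_locus g1 g2.
Proof.
move=> _ [v closure_v <-] f [[lip_fin fid] lip_least].
have [cov scX] := univ_p.
have [x0 _] := cov.2.1 point.
have conX := simply_connected_connected x0 scX.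
set x := foot v.
apply/eqP; rewrite /stretch_locus_of /= eq_le local_lip_le_lip /= leNgt.
(* Otherwise [f] contracts more strongly on a ball around [x]. *)
apply/negP => /ereal_inf_lt[_ [r /= r0 <-] lip_ball].
have ball_ge0 : (0 <= lip_on g1 g2 [set y | (riem_distM g1 x y <= r)%R] f)%E.
  have [y yr xy] := orbit_moves flow_phi v r0.
  apply: lip_on_ge0 xy => //=; rewrite /riem_distM riem_distxx; exact: ltW.
have lipE : lip g1 g2 f = (fine (lip g1 g2 f))%:E.
  by rewrite fineK// ge0_fin_numE// ltW// (le_lt_trans ball_ge0).
have ballE : (fine (lip_on g1 g2 [set y | (riem_distM g1 x y <= r)%R] f))%:E =
    lip_on g1 g2 [set y | (riem_distM g1 x y <= r)%R] f.
  by rewrite fineK// ge0_fin_numE// (lt_trans lip_ball).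
set L := fine (lip g1 g2 f) in lipE.
set K := fine (lip_on _ _ _ _) in ballE.
have K0 : 0 <= K by rewrite -lee_fin ballE.
have KL : K < L by rewrite -lte_fin ballE -lipE.
pose O := interior [set y | riem_distM g1 x y < r / 2].
have oO : open O by exact: open_interior.
have Ox : O x by apply: near_riem_distM; rewrite divr_gt0.
have oB := open_foot_preimage (g := g1) oO.
set B := _ @^-1` O in oB.
(* Some maximizing measure charges the geodesics starting close to [x]. *)
have [w [[m [inv stretch_m] supp_w] Bw]] :=
  closure_v B (open_nbhs_nbhs (conj oB Ox)).
have mB : (0 < m B)%E by exact: supp_w.
have bound : (max_stretch g2 phi p lft <= (K + (L - K) * fine (m (~` B)))%:E)%E.
  rewrite -stretch_m; apply: (geodesic_stretch_le hausdorffM compactM connectedM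
    flow_phi cov conX lift_lft fid inv r0 K0 (ltW KL) _ _ oO).
  - by rewrite ballE.
  - by rewrite lipE.
  - exact: interior_subset.
move: bound; rewrite stretch_eq_lip -lip_least lipE.
have BM : measurable (B : set (g_sigma_algebraType (@open (unit_tangent g1)))).
  exact: open_borel.
rewrite probability_setC// lee_fin leNgt => /negP; apply.
have mB_fin : m B = (fine (m B))%:E by rewrite fineK// fin_num_measure.
have mB_gt0 : 0 < fine (m B) by rewrite -lte_fin -mB_fin.
rewrite mB_fin -EFinB /= mulrBr mulr1 addrA [K + _]addrC subrK.
by rewrite ltrBlDr ltrDl mulr_gt0// subr_gt0.
Qed.
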